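(* Let $\mathcal{A}$ be a unital $C^*$-algebra of real rank zero with $\dim\mathcal{A}>1$. Then the set of elements in $\mathcal{A}$ with disconnected spectrum is open and dense in $\mathcal{A}$ (in the norm topology).
   Context: A unital $C^*$-algebra $\mathcal{A}$ has real rank zero if the set of self-adjoint elements with finite spectrum is norm dense in the set $\mathcal{A}_{sa}$ of self-adjoint elements of $\mathcal{A}$. *)

(* Defs.v *)
From HB Require Import structures.
From mathcomp Require Import all_boot all_order all_algebra.
From mathcomp Require Import all_classical all_reals all_analysis.
From mathcomp Require Import complex.

Set Implicit Arguments.
Unset Strict Implicit.
Unset Printing Implicit Defensive.

Import Order.TTheory GRing.Theory Num.Theory.
Import numFieldNormedType.Exports.

Local Open Scope classical_set_scope.
Local Open Scope ring_scope.
Local Open Scope complex_scope.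

(* The library's ring structures and norms on zmodules already have
   Num.NumDomain as their join, so no structure of normed rings can be declared
   on top of them. The product and the unit of a Banach algebra are therefore
   fields of a mixin over complete normed modules. *)
HB.mixin Record CompleteNormedModule_isBanachAlgebra (K : numFieldType) A
    & CompleteNormedModule K A := {
  bone : A;
  bmul : A -> A -> A;
  bmulA : associative bmul;
  bmul1l : left_id bone bmul;
  bmul1r : right_id bone bmul;
  bmulDl : left_distributive bmul +%R;
  bmulDr : right_distributive bmul +%R;
  bmulZl : forall (l : K) (a b : A), bmul (l *: a) b = l *: bmul a b;
  bmulZr : forall (l : K) (a b : A), bmul a (l *: b) = l *: bmul a b;
  ler_norm_bmul : forall a b : A, `|bmul a b| <= `|a| * `|b|
}.

#[short(type="banachAlgType")]
HB.structure Definition BanachAlgebra (K : numFieldType) :=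
  {A of CompleteNormedModule K A & CompleteNormedModule_isBanachAlgebra K A}.

(* The norm of a module over R[i] is valued in R[i]; it is nonnegative for the
   partial order of R[i], hence real. *)
HB.mixin Record BanachAlgebra_isCstarAlgebra (R : realType) A
    & BanachAlgebra R[i] A := {
  star : A -> A;
  starK : involutive star;
  starD : {morph star : a b / a + b};
  starZ : forall (l : R[i]) (a : A), star (l *: a) = l^* *: star a;
  starM : forall a b : A, star (bmul a b) = bmul (star b) (star a);
  cstar_norm : forall a : A, `|bmul (star a) a| = `|a| ^+ 2
}.

#[short(type="cstarAlgType")]
HB.structure Definition CstarAlgebra (R : realType) :=
  {A of BanachAlgebra R[i] A & BanachAlgebra_isCstarAlgebra R A}.

Section Cstar.
Variables (R : realType) (A : cstarAlgType R).

Definition self_adjoint (a : A) : Prop := star a = a.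

Definition invertible (a : A) : Prop :=
  exists b : A, bmul a b = bone /\ bmul b a = bone.

(* R[i]^o is R[i] with the topology of its norm. *)
Definition spectrum (a : A) : set R[i]^o :=
  [set l : R[i]^o | ~ invertible (a - (l : R[i]) *: bone)].

Definition real_rank_zero : Prop :=
  [set a : A | self_adjoint a] `<=`
  closure [set a : A | self_adjoint a /\ finite_set (spectrum a)].

Definition disconnected_spectrum (a : A) : Prop := ~ connected (spectrum a).

End Cstar.

Arguments real_rank_zero {R} A.

Section Dimension.
Variables (K : fieldType) (V : lmodType K).

Definition lin_indep (n : nat) (v : 'I_n -> V) : Prop :=
  forall c : 'I_n -> K, \sum_(i < n) c i *: v i = 0 -> forall i, c i = 0.

(* The dimension of V, finite or infinite, is greater than n. *)
Definition dim_gt (n : nat) : Prop := exists v : 'I_n.+1 -> V, lin_indep v.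

End Dimension.

Arguments dim_gt {K} V n.

(* Main.v *)
Require Import Defs.
From HB Require Import structures.
From mathcomp Require Import all_boot all_order all_algebra.
From mathcomp Require Import all_classical all_reals all_analysis.
From mathcomp Require Import complex.
From mathcomp Require Import ring lra.

(* Openness: for b near a the resolvent of b is bounded on a curve around a part
   of the spectrum of a; were b without spectrum inside, the maximum principle
   would carry the bound inside and a would have no spectrum there either.
   Density: let l be a point of the spectrum of a with almost maximal real part,
   and suppose that x = a - l has x^* x not invertible (otherwise pass to the
   adjoint of a). Real rank zero gives a projection p with x p small. Replacing a
   by u = a - x p + 2 e p makes the range of p an eigenspace for l + 2 e, to the
   right of the spectrum of a - x p, and the rest of the spectrum of u is not
   empty. *)

Set Implicit Arguments.
Unset Strict Implicit.
Unset Printing Implicit Defensive.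

Import Order.TTheory GRing.Theory Num.Theory.
Import numFieldNormedType.Exports.

Local Open Scope classical_set_scope.
Local Open Scope ring_scope.
Local Open Scope complex_scope.

(** No contour integral and no holomorphic functional calculus occur. The curve is the zero set of a
    continuous real function [h] whose sign separates the spectrum; for two disjoint nonempty closed
    sets the difference of their distance functions is such an [h]. The maximum principle comes from
    the resolvent identity: averaged over four points of a small circle, the terms of order 1 and 2
    cancel. Real rank zero gives projections only through self-adjoint elements of finite spectrum:
    a Lagrange polynomial in such an element is an eigenprojection, once a self-adjoint element with
    spectrum {0} is known to vanish. Hence the comparison of norm and spectral radius. As [x] need
    not be normal, the projection is found for [adj x * x], and the norm of [x * p] is at most the
    square root of that of [adj x * x * p]. If [adj x * x] and [x * adj x] were both units, so would
    be [x]; this is why one of [a] and its adjoint always works. The obstacle left is [p = 1]: no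
    complement remains, but then [a] is nearly scalar, and a nontrivial idempotent, available
    because the dimension exceeds 1, splits that scalar. *)

Section BanachRing.
Variables (K : numFieldType) (A : banachAlgType K).

(* The alias depends on nt because unitRingType requires 1 != 0. *)
Definition balg (nt : bone != 0 :> A) : Type := A.

Variable nt : bone != 0 :> A.
Local Notation B := (balg nt).

HB.instance Definition _ := CompleteNormedModule.copy B A.

Let bone_neq0 : (bone : B) != 0. Proof. exact: nt. Qed.

HB.instance Definition _ := @GRing.Zmodule_isNzRing.Build B
  bone bmul bmulA bmul1l bmul1r bmulDl bmulDr bone_neq0.

Let bscalerAl (k : K) (x y : B) : k *: (x * y) = (k *: x) * y.
Proof. by rewrite [RHS]bmulZl. Qed.

HB.instance Definition _ := GRing.Lmodule_isLalgebra.Build K B bscalerAl.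

Let bscalerAr (k : K) (x y : B) : k *: (x * y) = x * (k *: y).
Proof. by rewrite [RHS]bmulZr. Qed.

HB.instance Definition _ := GRing.Lalgebra_isAlgebra.Build K B bscalerAr.

Let bunit : pred B := fun x => `[< exists y, y * x = 1 /\ x * y = 1 >].
(** The default value [x] makes the inverse the identity off the units, as [binv_out] demands. *)
Let binv (x : B) : B := xget x [set y | y * x = 1 /\ x * y = 1].

Let binvP (x : B) : x \in bunit -> binv x * x = 1 /\ x * binv x = 1.
Proof. by move/asboolP=> [y xy]; rewrite /binv; case: xgetP => // /(_ y). Qed.

Let bmulVr : {in bunit, left_inverse 1 binv *%R}.
Proof. by move=> x /binvP[]. Qed.

Let bmulrV : {in bunit, right_inverse 1 binv *%R}.
Proof. by move=> x /binvP[]. Qed.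

Let bunitP (x y : B) : y * x = 1 /\ x * y = 1 -> bunit x.
Proof. by move=> xy; apply/asboolP; exists y. Qed.

Let binv_out : {in [predC bunit], binv =1 id}.
Proof.
move=> x; rewrite inE => /asboolP xU; rewrite /binv.
by case: xgetP => // y _ xy; case: xU; exists y.
Qed.

HB.instance Definition _ :=
  GRing.NzRing_hasMulInverse.Build B bmulVr bmulrV bunitP binv_out.

End BanachRing.

Arguments balg : simpl never.

(** * The norm with values in the ordered field [R] *)

Section RealNorm.
Variable R : realType.

Definition rnorm (V : normedZmodType R[i]) (x : V) : R := complex.Re `|x|.

Section Zmod.
Variable V : normedZmodType R[i].
Implicit Types x y : V.

Lemma rnormE x : `|x| = (rnorm x)%:C.
Proof. by rewrite /rnorm RRe_real// ger0_real. Qed.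

Lemma rnorm_ge0 x : 0 <= rnorm x.
Proof. by rewrite -lecR -rnormE rmorph0. Qed.

Lemma rnormD x y : rnorm (x + y) <= rnorm x + rnorm y.
Proof. by rewrite -lecR rmorphD/= -!rnormE ler_normD. Qed.

Lemma rnormN x : rnorm (- x) = rnorm x.
Proof. by rewrite /rnorm normrN. Qed.

Lemma rnorm_distC x y : rnorm (x - y) = rnorm (y - x).
Proof. by rewrite -rnormN opprB. Qed.

Lemma rnormB x y : rnorm (x - y) <= rnorm x + rnorm y.
Proof. by rewrite -(rnormN y) rnormD. Qed.

Lemma rnorm_tri y x z : rnorm (x - z) <= rnorm (x - y) + rnorm (y - z).
Proof. by rewrite -{1}(subrK y x) -addrA rnormD. Qed.

Lemma rnorm0 : rnorm (0 : V) = 0.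
Proof. by rewrite /rnorm normr0. Qed.

Lemma rnorm_eq0 x : (rnorm x == 0) = (x == 0).
Proof.
by rewrite -(normr_eq0 x) rnormE -(inj_eq (@complexI R)) rmorph0.
Qed.

Lemma rnorm_gt0 x : (0 < rnorm x) = (x != 0).
Proof. by rewrite lt_neqAle rnorm_ge0 eq_sym rnorm_eq0 andbT. Qed.

Lemma rnorm_small x : (forall e, 0 < e -> rnorm x < e) -> x = 0.
Proof.
move=> h; apply/eqP/contraT; rewrite -rnorm_gt0 => /[dup] /h.
by rewrite ltxx.
Qed.

End Zmod.

Lemma rnorm_nbhs (V : pseudoMetricNormedZmodType R[i]) (x : V) (P : set V) :
  nbhs x P <-> exists2 e : R, 0 < e & forall y, rnorm (y - x) < e -> P y.
Proof.
split=> [/nbhs_ballP[e /= e0 eP]|[e e0 eP]].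
  have eE : e = (complex.Re e)%:C by rewrite RRe_real// gtr0_real.
  exists (complex.Re e); first by rewrite -ltcR -eE.
  move=> y yx; apply: eP; rewrite -ball_normE /= eE.
  by rewrite rnormE ltcR rnorm_distC.
apply/nbhs_ballP; exists e%:C; first by rewrite /= ltcR.
move=> y; rewrite -ball_normE /= rnormE ltcR rnorm_distC; exact: eP.
Qed.

Lemma rnormM (z w : R[i]) : rnorm (z * w) = rnorm z * rnorm w.
Proof. by apply: complexI; rewrite rmorphM/= -!rnormE normrM. Qed.

Lemma rnorm1 : rnorm (1 : R[i]) = 1.
Proof. by rewrite /rnorm normr1. Qed.

Lemma rnormV (z : R[i]) : rnorm z^-1 = (rnorm z)^-1.
Proof. by apply: complexI; rewrite fmorphV/= -!rnormE normfV. Qed.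

Lemma rnorm_real (x : R) : rnorm x%:C = `|x|.
Proof.
by apply: complexI; rewrite -rnormE normc_def/= expr0n addr0 sqrtr_sqr.
Qed.

Lemma rnorm_sqr (z : R[i]) :
  rnorm z ^+ 2 = complex.Re z ^+ 2 + complex.Im z ^+ 2.
Proof.
by rewrite /rnorm normc_def/= sqr_sqrtr// addr_ge0// sqr_ge0.
Qed.

Lemma rnorm_i : rnorm ('i%C : R[i]) = 1.
Proof. by rewrite /rnorm normc_def/= expr0n expr1n add0r sqrtr1. Qed.

Lemma rnorm_conj (z : R[i]) : rnorm (z^*)%C = rnorm z.
Proof. by rewrite /rnorm normcJ. Qed.

Lemma rnormZ (V : normedModType R[i]) (z : R[i]) (x : V) :
  rnorm (z *: x) = rnorm z * rnorm x.
Proof. by apply: complexI; rewrite rmorphM/= -!rnormE normrZ. Qed.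

Lemma Re_rnorm (z : R[i]) : `|complex.Re z| <= rnorm z.
Proof. by rewrite -lecR -rnormE normc_ge_Re. Qed.

Lemma Im_rnorm (z : R[i]) : `|complex.Im z| <= rnorm z.
Proof.
rewrite -(ler_pXn2r (n := 2%N)) ?nnegrE ?rnorm_ge0//.
by rewrite rnorm_sqr real_normK ?num_real// lerDr sqr_ge0.
Qed.

End RealNorm.

(** * Neumann series and perturbation of inverses *)

Section BanachInverse.
Variables (R : realType) (A : banachAlgType R[i]) (nt : bone != 0 :> A).
Local Notation B := (balg nt).
Implicit Types (x y u v : B) (z w : R[i]).

Lemma rnorm_mul x y : rnorm (x * y) <= rnorm x * rnorm y.
Proof. by rewrite -lecR rmorphM/= -!rnormE; exact: ler_norm_bmul. Qed.

Lemma rnorm_cauchy (s : nat -> B) :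
  (forall e, 0 < e -> exists N, forall n, (N <= n)%N -> rnorm (s n - s N) < e) ->
  exists l, forall e, 0 < e -> exists N, forall n, (N <= n)%N -> rnorm (s n - l) < e.
Proof.
move=> sC.
have : cauchy (s @ \oo).
  apply: cauchy_exP => e e0.
  have eE : e = (complex.Re e)%:C by rewrite RRe_real// gtr0_real.
  have [|N sN] := sC (complex.Re e); first by rewrite -ltcR -eE.
  exists (s N); exists N => // n /= Nn.
  by rewrite -ball_normE /= eE rnormE ltcR rnorm_distC sN.
move=> /cauchy_cvg/cvg_ex[l sl]; exists l => e e0.
have : nbhs l [set y : B | rnorm (y - l) < e] by apply/rnorm_nbhs; exists e.
by move=> /sl[N _ sN]; exists N => n /sN.
Qed.

Lemma geometric_small (q C e : R) : 0 <= q < 1 -> 0 < e ->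
  exists N, forall n, (N <= n)%N -> C * q ^+ n < e.
Proof.
move=> /andP[q0 q1] e0.
have q1' : `|q| < 1 by rewrite ger0_norm.
have := cvg_geometric C q1' => /cvgr0Pnorm_lt/(_ _ e0)[N _ h].
exists N => n /h; exact: le_lt_trans (ler_norm _).
Qed.

(** The factor [rnorm 1] is there for exponent 0: a Banach algebra in the present sense may have a
    unit of norm greater than 1. *)
Lemma rnormX_le x n : rnorm (x ^+ n) <= rnorm (1 : B) * rnorm x ^+ n.
Proof.
elim: n => [|n IH]; first by rewrite !expr0 mulr1.
rewrite !exprSr mulrA (le_trans (rnorm_mul _ _))//.
by rewrite ler_wpM2r// rnorm_ge0.
Qed.

Lemma neumann x : rnorm x < 1 -> 1 - x \is a GRing.unit.
Proof.
move=> x1; set q := rnorm x in x1.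
have q0 : 0 <= q by exact: rnorm_ge0.
pose s n : B := \sum_(i < n) x ^+ i.
pose C := rnorm (1 : B) / (1 - q).
have C0 : 0 <= C by rewrite divr_ge0// ?rnorm_ge0// subr_ge0 ltW.
have sC n : rnorm (s n) <= C.
  elim: n => [|n IH]; first by rewrite /s big_ord0 rnorm0.
  rewrite /s big_ord_recl expr0.
  have -> : \sum_(i < n) x ^+ lift ord0 i = x * s n.
    by rewrite mulr_sumr; apply: eq_bigr => i _; rewrite -exprS.
  rewrite (le_trans (rnormD _ _))//.
  (* [C] is the fixed point of the recursive bound on the partial sums, which closes the
     induction. *)
  have -> : C = rnorm (1 : B) + q * C by rewrite /C; field; lra.
  by rewrite lerD2l (le_trans (rnorm_mul _ _))// ler_wpM2l.
have [l sl] : exists l : B, forall e, 0 < e -> exists N, forall n, (N <= n)%N ->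
    rnorm (s n - l) < e.
  apply: rnorm_cauchy => e e0.
  have [N hN] := @geometric_small q (rnorm (1 : B) * C) _ (introT andP (conj q0 x1)) e0.
  exists N => n Nn.
  have -> : s n - s N = x ^+ N * s (n - N)%N.
    rewrite -{1}(subnKC Nn) /s big_split_ord/= addrAC subrr add0r mulr_sumr.
    by apply: eq_bigr => i _; rewrite exprD.
  apply: le_lt_trans (hN N (leqnn _)); rewrite (le_trans (rnorm_mul _ _))//.
  rewrite mulrAC ler_pM ?rnorm_ge0//; exact: rnormX_le.
have xl : (1 - x) * l = l * (1 - x) /\ (1 - x) * l = 1.
  pose D := rnorm (1 - x).
  have D0 : 0 <= D by exact: rnorm_ge0.
  have small e : 0 < e -> exists2 n, rnorm (s n - l) < e & rnorm (x ^+ n) < e.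
    move=> e0; have [N hN] := sl _ e0.
    have [M hM] := @geometric_small q (rnorm (1 : B)) _ (introT andP (conj q0 x1)) e0.
    exists (maxn N M); first by rewrite hN// leq_maxl.
    apply: le_lt_trans (hM (maxn N M) (leq_maxr _ _)); exact: rnormX_le.
  have xs n : GRing.comm (1 - x) (s n).
    apply: commr_sum => i _; apply: commrX.
    by rewrite /GRing.comm mulrBl mulrBr mul1r mulr1.
  split; apply/eqP; rewrite -subr_eq0; apply/eqP/rnorm_small => e e0.
    have [|n n1 _] := small (e / (2 * D + 1)); first by rewrite divr_gt0//; lra.
    have -> : (1 - x) * l - l * (1 - x) = (s n - l) * (1 - x) - (1 - x) * (s n - l).
      move: (xs n); rewrite /GRing.comm; move: (1 - x) => y ys.
      by rewrite mulrBl mulrBr ys opprB [RHS]addrC addrA subrK.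
    rewrite (le_lt_trans (rnormB _ _))//.
    have e1 := rnorm_mul (s n - l) (1 - x).
    have e2 := rnorm_mul (1 - x) (s n - l).
    rewrite ltr_pdivlMr in n1; last by lra.
    have := rnorm_ge0 (s n - l); rewrite -/D in e1 e2; nra.
  have [|n n1 n2] := small (e / (D + 1)); first by rewrite divr_gt0//; lra.
  have -> : (1 - x) * l - 1 = - (x ^+ n) - (1 - x) * (s n - l).
    have := subrX1 x n; rewrite -/(s n) => h.
    have {}h : (1 - x) * s n = 1 - x ^+ n.
      by rewrite -(opprB x) mulNr -h opprB.
    by rewrite mulrBr h !opprB addrCA addKr.
  rewrite (le_lt_trans (rnormB _ _))// rnormN.
  have e2 := rnorm_mul (1 - x) (s n - l).
  rewrite ltr_pdivlMr in n1; last by lra.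
  rewrite ltr_pdivlMr in n2; last by lra.
  have := rnorm_ge0 (s n - l); rewrite -/D in e2; nra.
by apply/unitrP; exists l; case: xl => <- ->.
Qed.

(** Write [v = u * (1 - u^-1 * (u - v))] and use the Neumann series. The constant 1/2 lets the
    resolvent identity bound [rnorm v^-1] by [rnorm u^-1] plus half of itself, whence the factor
    2. *)
Lemma unit_perturb u v : u \is a GRing.unit -> rnorm (v - u) * rnorm u^-1 <= 2^-1 ->
  v \is a GRing.unit /\ rnorm v^-1 <= 2 * rnorm u^-1.
Proof.
move=> uU h.
have vE : v = u * (1 - u^-1 * (u - v)).
  by rewrite mulrBr mulr1 mulVKr// opprB addrC subrK.
have vU : v \is a GRing.unit.
  rewrite vE unitrMl//; apply: neumann.
  rewrite (le_lt_trans (rnorm_mul _ _))// rnorm_distC mulrC (le_lt_trans h)//.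
  lra.
split=> //.
have e1 := rnorm_mul (u^-1 * (v - u)) v^-1.
have e2 := rnorm_mul u^-1 (v - u).
have e3 := rnorm_ge0 v^-1.
have : rnorm v^-1 <= rnorm u^-1 + 2^-1 * rnorm v^-1.
  rewrite {1}(_ : v^-1 = u^-1 - u^-1 * (v - u) * v^-1); last first.
    by rewrite mulrBr mulVr// mulrBl mul1r mulrK// opprB addrC subrK.
  rewrite (le_trans (rnormB _ _))// lerD2l (le_trans e1)//.
  rewrite ler_wpM2r// (le_trans e2)// mulrC//.
move: e1 e2; set p := rnorm (u^-1 * _); set r := rnorm u^-1; nra.
Qed.
End BanachInverse.

(** * Continuity and compactness expressed with the real norm *)

Section RealNormContinuity.
Variable R : realType.

Lemma rnorm_continuousP (V W : pseudoMetricNormedZmodType R[i]) (f : V -> W) x :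
  {for x, continuous f} <-> forall e : R, 0 < e -> exists2 d : R, 0 < d &
    forall y, rnorm (y - x) < d -> rnorm (f y - f x) < e.
Proof.
split=> [fx e e0|fx P /rnorm_nbhs[e e0 eP]].
  have /fx/rnorm_nbhs[d d0 dP] : nbhs (f x) [set y | rnorm (y - f x) < e].
    by apply/rnorm_nbhs; exists e.
  by exists d.
have [d d0 dP] := fx e e0.
by apply/rnorm_nbhs; exists d => // y /dP; exact: eP.
Qed.

Lemma real_rnorm_continuousP (V : pseudoMetricNormedZmodType R[i]) (f : V -> R) x :
  {for x, continuous f} <-> forall e : R, 0 < e -> exists2 d : R, 0 < d &
    forall y, rnorm (y - x) < d -> `|f y - f x| < e.
Proof.
split=> [fx e e0|fx P /nbhs_ballP[e /= e0 eP]].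
  have /fx/rnorm_nbhs[d d0 dP] : nbhs (f x) [set y | `|y - f x| < e].
    by apply/nbhs_ballP; exists e => //= y; rewrite -ball_normE /= distrC.
  by exists d.
have [d d0 dP] := fx e e0.
apply/rnorm_nbhs; exists d => // y /dP yx; apply: eP.
by rewrite -ball_normE /= distrC.
Qed.

Lemma lipschitz_rnorm_continuous (V : pseudoMetricNormedZmodType R[i]) (f : V -> R)
    (L : R) :
  (forall x y, `|f x - f y| <= L * rnorm (x - y)) -> continuous f.
Proof.
move=> fL x; apply/real_rnorm_continuousP => e e0.
have L1 : 0 < `|L| + 1 by rewrite ltr_wpDl.
exists (e / (`|L| + 1)); first by rewrite divr_gt0.
move=> y; rewrite ltr_pdivlMr// => yx; rewrite (le_lt_trans (fL _ _))//.
have := rnorm_ge0 (y - x); have := ler_norm L; nra.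
Qed.

Lemma rnorm_continuous (V : pseudoMetricNormedZmodType R[i]) :
  continuous (@rnorm R V).
Proof.
apply: (@lipschitz_rnorm_continuous _ _ 1) => x y; rewrite mul1r ler_norml.
have le_dist (u v : V) : rnorm u <= rnorm (u - v) + rnorm v.
  by have := rnormD (u - v) v; rewrite subrK.
have := le_dist x y; have := le_dist y x; rewrite (rnorm_distC y x).
by move=> ? ?; apply/andP; split; lra.
Qed.

Lemma Re_continuous : continuous (@complex.Re R : R[i]^o -> R).
Proof.
apply: (@lipschitz_rnorm_continuous _ _ 1) => x y; rewrite mul1r.
by rewrite -raddfB Re_rnorm.
Qed.

(** A closed subset of the image of the square of side [2 * r] under [(x, y) |-> x + i y], so
    compactness of real segments suffices. *)
Lemma compact_sublevel (h : R[i]^o -> R) (r : R) : continuous h ->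
  (forall z, h z <= 0 -> rnorm z <= r) -> compact [set z | h z <= 0].
Proof.
move=> hC hr.
pose I := [set` `[- r, r]] : set R.
pose c (p : R * R) : R[i]^o := p.1 +i* p.2.
have cC : continuous c.
  move=> p P /rnorm_nbhs[e e0 eP].
  apply/nbhs_ballP; exists (e / 2); first by rewrite /= divr_gt0.
  case=> x y [/=]; rewrite /ball/= => px py; apply: eP.
  have -> : c (x, y) - c p = (x - p.1)%:C + (y - p.2)%:C * 'i%C.
    by rewrite /c/=; simpc.
  rewrite (le_lt_trans (rnormD _ _))// rnormM.
  rewrite rnorm_i !rnorm_real mulr1 (distrC x) (distrC y); lra.
apply: (@subclosed_compact _ _ (c @` (I `*` I))).
- have -> : [set z | h z <= 0] = h @^-1` [set x | x <= 0] by [].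
  by apply: closed_comp => [x _|]; [exact: hC|exact: closed_le].
- apply: continuous_compact; first exact: continuous_subspaceT.
  by apply: compact_setX; exact: segment_compact.
- move=> z /= /hr zr; exists (complex.Re z, complex.Im z); last by case: z zr.
  by split; rewrite /I/= in_itv/= -ler_norml (le_trans _ zr)// ?Re_rnorm ?Im_rnorm.
Qed.

End RealNormContinuity.

(** * Continuity of the inverse and bounds on compact sets *)

Section Resolvent.
Variables (R : realType) (A : banachAlgType R[i]) (nt : bone != 0 :> A).
Local Notation B := (balg nt).
Implicit Types (a b x y u v : B) (z w : R[i]).

Lemma inv_continuous u : u \is a GRing.unit -> {for u, continuous (@GRing.inv B)}.
Proof.
move=> uU; apply/rnorm_continuousP => e e0.
set K := rnorm u^-1; have K0 : 0 <= K := rnorm_ge0 _.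
(* The first term makes [unit_perturb] applicable; the second makes [2 * K ^+ 2 * rnorm (v - u)], a
   bound for the difference of the inverses, less than [e]. *)
exists (Num.min (2^-1 / (K + 1)) (e / (2 * K ^+ 2 + 1))).
  rewrite lt_min !divr_gt0//; nra.
move=> v; rewrite lt_min ltr_pdivlMr; last by lra.
rewrite ltr_pdivlMr; last by nra.
move=> /andP[v1 v2]; have d0 := rnorm_ge0 (v - u).
have [vU vK] : v \is a GRing.unit /\ rnorm v^-1 <= 2 * K.
  by apply: unit_perturb => //; rewrite -/K; nra.
have -> : v^-1 - u^-1 = v^-1 * (u - v) * u^-1.
  by rewrite mulrBr mulVr// mulrBl mul1r mulrK// .
have e1 := rnorm_mul (v^-1 * (u - v)) u^-1.
have e2 := rnorm_mul v^-1 (u - v); rewrite rnorm_distC -/K in e1 e2.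
have e3 := rnorm_ge0 v^-1.
rewrite (le_lt_trans e1)//.
have : rnorm (v^-1 * (u - v)) * K <= 2 * K * rnorm (v - u) * K.
  by rewrite ler_wpM2r// (le_trans e2)// ler_wpM2r.
nra.
Qed.

Lemma sub_scale_continuous a y :
  continuous (fun z : R[i]^o => a - (z : R[i]) *: y : B).
Proof.
move=> z; apply/rnorm_continuousP => e e0.
have c0 := rnorm_ge0 y.
exists (e / (rnorm y + 1)); first by rewrite divr_gt0//; lra.
move=> w; rewrite ltr_pdivlMr; last by lra.
have -> : a - (w : R[i]) *: y - (a - (z : R[i]) *: y) = - ((w - z : R[i]) *: y) :> B.
  by rewrite opprB addrACA addrC addrA subrK scalerBl opprB addrC.
rewrite rnormN rnormZ => h; have := rnorm_ge0 (w - z).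
by move: h; rewrite /GRing.regular; nra.
Qed.

Lemma compact_inv_bounded (F : set R[i]^o) (u : R[i]^o -> B) : compact F ->
  continuous u -> (forall z, F z -> u z \is a GRing.unit) ->
  exists2 M, 0 < M & forall z, F z -> rnorm (u z)^-1 <= M.
Proof.
move=> cF uC uF.
have [->|/set0P F0] := eqVneq F set0; first by exists 1.
have [z Fz zM] : exists2 z, z \in F & forall w, w \in F -> rnorm (u w)^-1 <= rnorm (u z)^-1.
  apply: (@compact_EVT_max R[i]^o R (fun z => rnorm (u z)^-1) F) => //.
  apply: continuous_in_subspaceT => z /set_mem Fz.
  apply: continuous_comp; last exact: rnorm_continuous.
  by apply: continuous_comp; [exact: uC|apply: inv_continuous; exact: uF].
exists (rnorm (u z)^-1 + 1); first by rewrite ltr_wpDl// rnorm_ge0.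
by move=> w Fw; rewrite (le_trans (zM w _)) ?inE// lerDl.
Qed.

End Resolvent.

(** * Maximum principle for the resolvent *)

Section SpectralSemicontinuity.
Variables (R : realType) (A : banachAlgType R[i]) (nt : bone != 0 :> A).
Local Notation B := (balg nt).
Implicit Types (a b x y u v : B) (z w t : R[i]).

(** The identity T = S + t S T, used three times, gives the Taylor expansion of order 2 with exact
    remainder. The remainder stands on the left, so that the right side is a quadratic polynomial in
    [t]. *)
Lemma resolvent_expansion a z t : a - z%:A \is a GRing.unit ->
  a - (z + t)%:A \is a GRing.unit ->
  (a - (z + t)%:A)^-1 - t ^+ 3 *: ((a - z%:A)^-1 ^+ 3 * (a - (z + t)%:A)^-1) =
  (a - z%:A)^-1 + t *: (a - z%:A)^-1 ^+ 2 + t ^+ 2 *: (a - z%:A)^-1 ^+ 3.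
Proof.
move=> zU ztU; set S := (a - z%:A)^-1; set T := (a - (z + t)%:A)^-1.
have TE : T = S + t *: (S * T).
  have -> : t *: (S * T) = S * (a - z%:A - (a - (z + t)%:A)) * T.
    rewrite opprB addrC addrA subrK scalerDl (addrC z%:A) addrK.
    by rewrite -scalerAr mulr1 -scalerAl.
  by rewrite mulrBr mulVr// mulrBl mul1r mulrK// addrC subrK.
have TE2 : T = S + t *: S ^+ 2 + t ^+ 2 *: (S ^+ 2 * T).
  by rewrite {1}TE {1}TE mulrDr scalerDr -scalerAr scalerA mulrA !expr2 addrA.
rewrite {1}TE2 {1}TE mulrDr scalerDr -scalerAr scalerA mulrA -!exprSr !addrA.
by rewrite addrK.
Qed.

(** A discrete substitute for Cauchy's formula: over the points r, -r, ir, -ir both [t] and [t ^+ 2]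
    sum to zero, so the average of the quadratic polynomial is its constant term, and the error has
    order [r ^+ 3]. *)
Lemma mean_value_bound a z (r G : R) : 0 <= r ->
  a - z%:A \is a GRing.unit ->
  (forall t, rnorm t = r -> a - (z + t)%:A \is a GRing.unit /\
     rnorm (a - (z + t)%:A)^-1 <= G) ->
  4 * rnorm (a - z%:A)^-1 <=
    rnorm (a - (z + r%:C)%:A)^-1 + rnorm (a - (z - r%:C)%:A)^-1 +
    rnorm (a - (z + 'i%C * r%:C)%:A)^-1 + rnorm (a - (z - 'i%C * r%:C)%:A)^-1 +
    4 * (r ^+ 3 * (rnorm ((a - z%:A)^-1 ^+ 3) * G)).
Proof.
move=> r0 zU zG; set S := (a - z%:A)^-1.
pose T t := (a - (z + t)%:A)^-1.
pose E t := T t - t ^+ 3 *: (S ^+ 3 * T t).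
have EE t : rnorm t = r -> E t = S + t *: S ^+ 2 + t ^+ 2 *: S ^+ 3.
  by move=> /zG[tU _]; rewrite /E resolvent_expansion.
have En t : rnorm t = r -> rnorm (E t) <= rnorm (T t) + r ^+ 3 * (rnorm (S ^+ 3) * G).
  move=> tr; rewrite (le_trans (rnormB _ _))// lerD2l rnormZ.
  have [_ TG] := zG _ tr.
  have -> : rnorm (t ^+ 3) = r ^+ 3 by rewrite !exprS expr0 !rnormM rnorm1 tr.
  rewrite ler_wpM2l ?exprn_ge0// (le_trans (rnorm_mul _ _))//.
  by rewrite ler_wpM2l ?rnorm_ge0.
have n1 : rnorm r%:C = r by rewrite rnorm_real ger0_norm.
have n2 : rnorm (- r%:C) = r by rewrite rnormN.
have n3 : rnorm ('i%C * r%:C) = r by rewrite rnormM rnorm_i mul1r.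
have n4 : rnorm (- ('i%C * r%:C)) = r by rewrite rnormN.
have S4 : 4 *: S = E r%:C + E (- r%:C) + E ('i%C * r%:C) + E (- ('i%C * r%:C)).
  rewrite !EE// !sqrrN exprMn sqr_i mulN1r !scaleNr.
  have pair X Y : (S + X + Y) + (S - X + Y) = S + S + (Y + Y) :> B.
    by rewrite addrACA (addrACA S) subrr addr0.
  rewrite -[RHS]addrA !pair addrACA -opprD subrr addr0.
  by rewrite (_ : 4 = 1 + 1 + (1 + 1)) ?scalerDl ?scale1r//; ring.
have := En _ n1; have := En _ n2; have := En _ n3; have := En _ n4.
have : 4 * rnorm S <= rnorm (E r%:C) + rnorm (E (- r%:C)) +
   rnorm (E ('i%C * r%:C)) + rnorm (E (- ('i%C * r%:C))).
  have -> : 4 * rnorm S = rnorm (4 *: S).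
    by rewrite rnormZ -(rmorph_nat (@real_complex R) 4) rnorm_real ger0_norm.
  rewrite S4 !(le_trans (rnormD _ _))// !lerD// !(le_trans (rnormD _ _))//.
  by rewrite !lerD// rnormD.
rewrite -/(T r%:C) -/(T (- r%:C)) -/(T ('i%C * r%:C)) -/(T (- ('i%C * r%:C))).
lra.
Qed.

(** The region is [h <= 0], and the bound known on [h = 0] plays the part of a bound on the
    boundary. If [b] had no spectrum with [h < 0], its resolvent at [z0] would be bounded by [N],
    and [a - z0%:A] would be a perturbation of [b - z0%:A] small enough to be a unit. *)
Lemma spectrum_lsc (h : R[i]^o -> R) (r : R) a z0 : continuous h ->
  (forall z, h z <= 0 -> rnorm z <= r) ->
  h z0 < 0 -> a - z0%:A \isn't a GRing.unit ->
  (forall z, h z = 0 -> a - z%:A \is a GRing.unit) ->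
  exists2 d : R, 0 < d & forall b, rnorm (b - a) < d ->
    exists2 z, h z < 0 & b - z%:A \isn't a GRing.unit.
Proof.
move=> hC hr hz0 z0U a0.
have cF : compact [set z | h z <= 0] by exact: compact_sublevel hr.
have c0 : compact [set z | h z = 0].
  apply: subclosed_compact cF _ => [|z /= ->//].
  by apply: (@closed_comp _ _ h [set 0]) => [x _|]; [exact: hC|exact: closed_eq].
have [M M0 aM] : exists2 M, 0 < M & forall z, h z = 0 -> rnorm (a - z%:A)^-1 <= M.
  by apply: (@compact_inv_bounded _ _ nt _ _ c0) => //; exact: sub_scale_continuous.
have r0 : 0 <= r by apply: le_trans (hr z0 (ltW hz0)); exact: rnorm_ge0.
(* [2 * M] bounds the resolvent of [b] on the zero set after perturbation, and [r ^+ 2] bounds the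
   term added to it in [g] below. *)
pose N := 2 * M + r ^+ 2.
have N0 : 0 < N by rewrite /N; nra.
exists (2^-1 / N); first by rewrite divr_gt0.
move=> b; rewrite ltr_pdivlMr// => ba; have d0 := rnorm_ge0 (b - a).
apply: contrapT => nb.
have bU z : h z < 0 -> b - z%:A \is a GRing.unit.
  by move=> hz; apply: contrapT => /negP zU; apply: nb; exists z.
have subz z : b - z%:A - (a - z%:A) = b - a by rewrite opprB addrA subrK.
have b0 z : h z = 0 -> b - z%:A \is a GRing.unit /\ rnorm (b - z%:A)^-1 <= 2 * M.
  move=> hz; have az := aM z hz.
  have [||zU zM] := @unit_perturb _ _ nt (a - z%:A) (b - z%:A).
  - exact: a0.
  - by rewrite subz; have := rnorm_ge0 (a - z%:A)^-1; rewrite /N in ba; nra.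
  - by split=> //; lra.
have bF z : h z <= 0 -> b - z%:A \is a GRing.unit.
  by rewrite le_eqVlt => /orP[/eqP/b0[]//|/bU].
(* Adding |z|^2 makes the function strictly subharmonic, which rules out an
   interior maximum without a connectedness argument. *)
pose g (z : R[i]^o) : R := rnorm (b - (z : R[i])%:A)^-1 + rnorm z ^+ 2.
have [zs Fzs gmax] : exists2 z, z \in [set z | h z <= 0] &
    forall w, w \in [set z | h z <= 0] -> g w <= g z.
  apply: (@compact_EVT_max R[i]^o R g [set z | h z <= 0]) => //.
    by exists z0 => /=; exact: ltW.
  apply: continuous_in_subspaceT => z /set_mem /= Fz.
  have c1 : {for z, continuous (fun z : R[i]^o => rnorm (b - (z : R[i])%:A)^-1)}.
    apply: (@continuous_comp _ _ _ _ (fun x : B => rnorm x)); last exact: rnorm_continuous.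
    apply: (@continuous_comp _ _ _ (fun z : R[i]^o => b - (z : R[i])%:A : B) (@GRing.inv B)).
      exact: sub_scale_continuous.
    by apply: inv_continuous; exact: bF.
  have c2 : {for z, continuous (fun z : R[i]^o => rnorm z)} by exact: rnorm_continuous.
  exact: (continuousD c1 (continuousM c2 c2)).
have {}gmax w : h w <= 0 -> g w <= g zs by move=> hw; apply: gmax; rewrite inE.
move/set_mem: Fzs => /= hzs.
have gN : g zs <= N.
  move: (hzs); rewrite le_eqVlt => /orP[/eqP /[dup] /b0[_ ?] h0|hzs0].
    by rewrite lerD// lerXn2r// ?nnegrE ?rnorm_ge0// hr.
  exfalso.
  have [e e0 eh] : exists2 e : R, 0 < e & forall w, rnorm (w - zs) < e -> h w <= 0.
    have h0 : 0 < - h zs by rewrite oppr_gt0.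
    have [e e0 eP] := (real_rnorm_continuousP h zs).1 (hC zs) _ h0.
    by exists e => // w /eP; rewrite ltr_norml => /andP[_]; lra.
  set S := (b - zs%:A)^-1 in g gmax *.
  pose G := g zs; pose Q := rnorm (S ^+ 3) * G.
  have G0 : 0 <= G by rewrite addr_ge0 ?rnorm_ge0// sqr_ge0.
  have Q0 : 0 <= Q by rewrite mulr_ge0// rnorm_ge0.
  (* A circle of radius [p < e] stays in the region. At its four points the squared norms sum to
     [4 * p ^+ 2] more than at the centre, whereas the error of the mean value is [4 * p ^+ 3 * Q];
     [p * Q < 1] makes the gain win, against the maximality of [zs]. *)
  pose p := Num.min (e / 2) (2 * (Q + 1))^-1.
  have p0 : 0 < p by rewrite lt_min divr_gt0//= invr_gt0; lra.
  have pe : p < e by rewrite gt_min; apply/orP; left; lra.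
  have pQ : p * Q < 1.
    have : p <= (2 * (Q + 1))^-1 by rewrite ge_min lexx orbT.
    rewrite -[_^-1]mul1r ler_pdivlMr; last by lra.
    nra.
  have hin t : rnorm t = p -> h (zs + t) <= 0.
    by move=> tp; apply: eh; rewrite addrC addKr tp.
  have := @mean_value_bound b zs p G (ltW p0) (bF _ hzs).
  rewrite -/S -/Q => /(_ _)/wrap[].
    move=> t tp; split; first by apply: bF; exact: hin.
    by apply: le_trans (gmax _ (hin _ tp)); rewrite lerDl sqr_ge0.
  have n1 : rnorm p%:C = p by rewrite rnorm_real ger0_norm// ltW.
  have n2 : rnorm (- p%:C) = p by rewrite rnormN.
  have n3 : rnorm ('i%C * p%:C) = p by rewrite rnormM rnorm_i mul1r.
  have n4 : rnorm (- ('i%C * p%:C)) = p by rewrite rnormN.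
  have := gmax _ (hin _ n1); have := gmax _ (hin _ n2).
  have := gmax _ (hin _ n3); have := gmax _ (hin _ n4).
  rewrite /g -/S !rnorm_sqr.
  case: (zs : R[i]) => x y; simpc => /=.
  have : p ^+ 3 * Q < p ^+ 2 by rewrite exprSr -mulrA gtr_pMr// exprn_gt0.
  lra.
have hz0b : rnorm (b - z0%:A)^-1 <= N.
  by apply: le_trans (le_trans (gmax _ (ltW hz0)) gN); rewrite lerDl sqr_ge0.
move/negP: z0U; apply.
have [||//] := @unit_perturb _ _ nt (b - z0%:A) (a - z0%:A).
  exact: bU.
rewrite rnorm_distC subz; have := rnorm_ge0 (b - z0%:A)^-1; nra.
Qed.

End SpectralSemicontinuity.

(** * Nonempty spectra and stability of a separated spectrum *)

Section SpectrumStability.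
Variables (R : realType) (A : banachAlgType R[i]) (nt : bone != 0 :> A).
Local Notation B := (balg nt).
Implicit Types (a b x y u v : B) (z w t : R[i]).

Lemma unit_sub_scalar a z : rnorm a < rnorm z -> a - z%:A \is a GRing.unit.
Proof.
move=> az.
have z0 : z != 0 by rewrite -rnorm_gt0 (le_lt_trans (rnorm_ge0 a)).
have -> : a - z%:A = (- z) *: (1 - z^-1 *: a).
  by rewrite scalerBr scalerA mulNr divff// scaleN1r opprK scaleNr addrC.
rewrite scaler_unit ?unitfE ?oppr_eq0//; apply: neumann.
by rewrite rnormZ rnormV mulrC ltr_pdivrMr ?rnorm_gt0// mul1r.
Qed.

Lemma scale_unit_sub t a z : t != 0 ->
  (t *: a - (t * z)%:A \is a GRing.unit) = (a - z%:A \is a GRing.unit).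
Proof. by move=> t0; rewrite -scalerA -scalerBr scaler_unit ?unitfE. Qed.

(** Semicontinuity at 0 replaces Liouville's theorem: 0 has spectrum {0} inside the unit disc, so
    every element near 0 has spectrum there, and any [a] can be scaled to be near 0. *)
Lemma spectrum_nonempty a : exists z, a - z%:A \isn't a GRing.unit.
Proof.
have scalU z : (0 : B) - z%:A \is a GRing.unit = (z != 0).
  have [->|z0] := eqVneq z 0; first by rewrite scale0r subr0 unitr0.
  by apply: unit_sub_scalar; rewrite rnorm0 rnorm_gt0.
have [|||||d d0 dP] := @spectrum_lsc R A nt (fun z => rnorm z - 1) 1 0 0.
- move=> z; apply: continuousB; first exact: rnorm_continuous.
  exact: cst_continuous.
- by move=> z; rewrite subr_le0.
- by rewrite rnorm0 sub0r oppr_lt0.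
- by rewrite scalU eqxx.
- move=> z /eqP; rewrite subr_eq0 scalU => /eqP z1.
  by apply/eqP => z0; move: z1; rewrite z0 rnorm0 => /eqP; rewrite eq_sym oner_eq0.
pose t : R := d / (rnorm a + 1).
have a0 := rnorm_ge0 a.
have t0 : 0 < t by rewrite divr_gt0//; lra.
have tC : t%:C != 0 :> R[i] by rewrite -rnorm_gt0 rnorm_real normr_gt0 gt_eqF.
have [|z _ zU] := dP (t%:C *: a).
  rewrite subr0 rnormZ rnorm_real ger0_norm ?ltW//.
  by rewrite /t mulrAC ltr_pdivrMr; [nra|lra].
by exists (t%:C^-1 * z); rewrite -(scale_unit_sub _ _ tC) mulVKf.
Qed.

(** The region [h <= 0] may be unbounded. Inside the disc of radius [rnorm a + 1] compactness bounds
    the resolvent; outside it every [b] with [rnorm (b - a) < 1] has norm too small to have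
    spectrum. *)
Lemma spectrum_usc (h : R[i]^o -> R) a : continuous h ->
  (forall z, h z <= 0 -> a - z%:A \is a GRing.unit) ->
  exists2 d : R, 0 < d & forall b, rnorm (b - a) < d ->
    forall z, h z <= 0 -> b - z%:A \is a GRing.unit.
Proof.
move=> hC ha; pose r := rnorm a + 1.
pose k (z : R[i]^o) := Num.max (h z) (rnorm z - r).
have kC : continuous k.
  move=> z; apply: (@continuous_max R _ h (fun z => rnorm z - r)); first exact: hC.
  by apply: continuousB; [exact: rnorm_continuous|exact: cst_continuous].
have cF : compact [set z | k z <= 0].
  by apply: (compact_sublevel (r := r) kC) => z; rewrite ge_max subr_le0 => /andP[].
have [|z /=|M M0 aM] := compact_inv_bounded (u := fun z : R[i]^o => a - (z : R[i])%:A : B) cF.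
- exact: sub_scale_continuous.
- by rewrite ge_max => /andP[/ha].
exists (Num.min 1 (2^-1 / M)); first by rewrite lt_min ltr01 divr_gt0.
move=> b; rewrite lt_min ltr_pdivlMr// => /andP[b1 bM] z hz.
have [zr|zr] := leP (rnorm z) r.
  have [||//] := @unit_perturb _ _ nt (a - z%:A) (b - z%:A); first exact: ha.
  have -> : b - z%:A - (a - z%:A) = b - a by rewrite opprB addrA subrK.
  have zM : rnorm (a - z%:A)^-1 <= M by apply: aM; rewrite /k/= ge_max hz subr_le0.
  have := rnorm_ge0 (b - a); nra.
apply: unit_sub_scalar.
have := rnorm_tri a b 0; rewrite !subr0; rewrite /r in zr; lra.
Qed.

(** Lower semicontinuity is applied to [h] and to [- h]; upper semicontinuity to [|h|], whose
    sublevel set at 0 is the zero set. *)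
Lemma separated_spectrum_stable (h : R[i]^o -> R) a z1 z2 : continuous h ->
  h z1 < 0 -> a - z1%:A \isn't a GRing.unit ->
  0 < h z2 -> a - z2%:A \isn't a GRing.unit ->
  (forall z, h z = 0 -> a - z%:A \is a GRing.unit) ->
  exists2 d : R, 0 < d & forall b, rnorm (b - a) < d ->
    [/\ forall z, h z = 0 -> b - z%:A \is a GRing.unit,
        exists2 z, h z < 0 & b - z%:A \isn't a GRing.unit &
        exists2 z, 0 < h z & b - z%:A \isn't a GRing.unit].
Proof.
move=> hC hz1 z1U hz2 z2U ha.
pose r := rnorm a + 1.
have neg (k : R[i]^o -> R) z0 : continuous k -> k z0 < 0 ->
    a - z0%:A \isn't a GRing.unit ->
    (forall z, k z = 0 -> a - z%:A \is a GRing.unit) ->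
    exists2 d : R, 0 < d & forall b, rnorm (b - a) < d ->
    exists2 z, k z < 0 & b - z%:A \isn't a GRing.unit.
  move=> kC kz0 z0U ka.
  (* The maximum cuts the region down to a disc, which costs only a boundary circle of radius
     [rnorm a + 1], free of spectrum of [a]. *)
  have [|||||d d0 dP] := @spectrum_lsc _ _ nt
    (fun z => Num.max (k z) (rnorm z - r)) r a z0.
  - move=> z; apply: (@continuous_max R _ k (fun z => rnorm z - r)).
      exact: kC.
    by apply: continuousB; [exact: rnorm_continuous|exact: cst_continuous].
  - by move=> z; rewrite ge_max subr_le0 => /andP[].
  - rewrite gt_max kz0/= subr_lt0; apply: contraNT z0U; rewrite -leNgt => z0r.
    by apply: unit_sub_scalar; apply: lt_le_trans z0r; rewrite ltrDl.
  - by [].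
  - move=> z; case: (leP (k z) (rnorm z - r)) => _; last exact: ka.
    move=> /eqP; rewrite subr_eq0 => /eqP zr.
    by apply: unit_sub_scalar; rewrite zr ltrDl.
  exists d => // b /dP[z]; rewrite gt_max => /andP[kz _] zU.
  by exists z.
have [d1 d10 d1P] := neg _ _ hC hz1 z1U ha.
have [||||d2 d20 d2P] := neg (fun z => - h z) z2.
- by move=> z; apply: continuousN; exact: hC.
- by rewrite oppr_lt0.
- by [].
- by move=> z /eqP; rewrite oppr_eq0 => /eqP /ha.
have [||d3 d30 d3P] := @spectrum_usc (fun z => `|h z|) a.
- move=> z; apply: (@continuous_comp _ _ _ h Num.norm); first exact: hC.
  exact: norm_continuous.
- by move=> z; rewrite normr_le0 => /eqP /ha.
exists (Num.min d1 (Num.min d2 d3)); first by rewrite !lt_min d10 d20 d30.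
move=> b; rewrite !lt_min => /and3P[/d1P b1 /d2P[z b2 zU] /d3P b3]; split=> //.
  by move=> w hw; apply: b3; rewrite hw normr0.
by exists z => //; rewrite -oppr_lt0.
Qed.

End SpectrumStability.

(** * Disconnected closed subsets of the plane *)

Section Disconnected.
Variable R : realType.
Implicit Types (K S : set R[i]^o) (z w : R[i]^o).

Let dist K z : R := inf [set rnorm (z - w) | w in K].

Let has_inf_dist K z : K !=set0 -> has_inf [set rnorm (z - w) | w in K].
Proof.
move=> [w Kw]; split; first by exists (rnorm (z - w)), w.
by exists 0 => _ [v _ <-]; exact: rnorm_ge0.
Qed.

Let dist_continuous K : K !=set0 -> continuous (dist K).
Proof.
move=> K0; have dle z w : dist K z <= rnorm (z - w) + dist K w.
  rewrite -lerBlDl; apply: lb_le_inf; first by case: (has_inf_dist w K0).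
  move=> _ [v Kv <-]; rewrite lerBlDl (le_trans _ (rnorm_tri w z v))//.
  by apply: ge_inf; [case: (has_inf_dist z K0)|exists v].
apply: (@lipschitz_rnorm_continuous _ _ _ 1) => z w; rewrite mul1r.
have := dle z w; have := dle w z; rewrite (rnorm_distC w z).
by rewrite ler_norml => ? ?; apply/andP; split; lra.
Qed.

Let dist_eq0 K z : K z -> dist K z = 0.
Proof.
move=> Kz; have K0 : K !=set0 by exists z.
apply/eqP; rewrite eq_le; apply/andP; split.
  apply: ge_inf; first by case: (has_inf_dist z K0).
  by exists z => //; rewrite subrr rnorm0.
apply: lb_le_inf; first by case: (has_inf_dist z K0).
by move=> _ [v _ <-]; exact: rnorm_ge0.
Qed.

Let dist_gt0 K z : K !=set0 -> closed K -> ~ K z -> 0 < dist K z.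
Proof.
move=> K0 Kc Kz; have : nbhs z (~` K) by apply: open_nbhs_nbhs; split => //; exact: closed_openC.
move=> /rnorm_nbhs[e e0 eP]; apply: lt_le_trans e0 _.
apply: lb_le_inf; first by case: (has_inf_dist z K0).
move=> _ [v Kv <-]; rewrite leNgt; apply/negP; rewrite rnorm_distC => /eP.
exact.
Qed.

(** A relatively clopen part [K] of a closed [S] and its complement [L] in [S] are both closed in
    the plane, so each has positive distance from any point of the other, and the difference of the
    distances separates them. *)
Lemma not_connectedP S : closed S -> ~ connected S <->
  exists h : R[i]^o -> R, [/\ continuous h, forall z, S z -> h z != 0,
    exists2 z, S z & h z < 0 & exists2 z, S z & 0 < h z].
Proof.
move=> cS; split.
  move=> nS; apply: contrapT => nh; apply: nS => K K0 [U oU KU] [C cC KC].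
  apply/seteqP; split; first by rewrite KU => z [].
  apply: contrapT => /existsNP[w /not_implyP[Sw Kw]]; apply: nh.
  pose L := S `&` ~` U.
  have L0 : L !=set0 by exists w; split => // Uw; apply: Kw; rewrite KU.
  have cL : closed L by apply: closedI => //; exact: open_closedC.
  have cK : closed K by rewrite KC; exact: closedI.
  have KL z : K z -> ~ L z by rewrite KU => -[_ Uz] [].
  have Kpos z : K z -> dist K z - dist L z < 0.
    by move=> Kz; rewrite (dist_eq0 Kz) sub0r oppr_lt0 dist_gt0//; exact: KL.
  have Lpos z : L z -> 0 < dist K z - dist L z.
    move=> Lz; rewrite (dist_eq0 Lz) subr0 dist_gt0//.
    by move=> /KL; exact.
  exists (fun z => dist K z - dist L z); split.
  - by move=> z; apply: continuousB; exact: dist_continuous.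
  - move=> z Sz; have [Uz|Uz] := pselect (U z).
      by rewrite lt_eqF// Kpos// KU.
    by rewrite gt_eqF// Lpos.
  - by case: K0 => z Kz; exists z; [move: Kz; rewrite KU => -[]|exact: Kpos].
  - by case: L0 => z Lz; exists z; [case: Lz|exact: Lpos].
move=> [h [hC h0 [z1 S1 hz1] [z2 S2 hz2]]] connS.
suff : S `&` [set z | h z < 0] = S.
  by move=> E; move: S2; rewrite -E => -[_ /=]; rewrite ltNge (ltW hz2).
apply: connS; first by exists z1.
  exists [set z | h z < 0] => //.
  apply: (@open_comp _ _ h [set x | x < 0]); last exact: open_lt.
  by move=> z _; exact: hC.
exists [set z | h z <= 0]; last first.
  apply/seteqP; split=> z [Sz /= hz]; split=> //=; first exact: ltW.
  by rewrite lt_neqAle h0.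
apply: (@closed_comp _ _ h [set x | x <= 0]); last exact: closed_le.
by move=> z _; exact: hC.
Qed.

End Disconnected.

(** * The adjoint, and the norm of a self-adjoint element against its spectral radius *)

Section SelfAdjoint.
Variables (R : realType) (A : cstarAlgType R) (nt : bone != 0 :> A).
Local Notation B := (balg nt).
Implicit Types (a b x y u v p : B) (z w t : R[i]).

Definition adj (x : B) : B := star (x : A).

Lemma adjK : involutive adj. Proof. exact: starK. Qed.

Lemma adjD : {morph adj : x y / x + y}. Proof. exact: starD. Qed.

Lemma adjM x y : adj (x * y) = adj y * adj x. Proof. exact: starM. Qed.

Lemma adjZ z x : adj (z *: x) = (z^*)%C *: adj x. Proof. exact: starZ. Qed.

Lemma adj0 : adj 0 = 0.
Proof. by apply: (addrI (adj 0)); rewrite -adjD !addr0. Qed.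

Lemma adjN x : adj (- x) = - adj x.
Proof. by apply/eqP; rewrite -addr_eq0 -adjD addNr adj0. Qed.

Lemma adjB : {morph adj : x y / x - y}.
Proof. by move=> x y; rewrite adjD adjN. Qed.

Lemma adj1 : adj 1 = 1.
Proof. by rewrite -[LHS]mul1r -{1}(adjK 1) -adjM mul1r adjK. Qed.

Lemma adj_scalar z : adj z%:A = (z^*)%C%:A.
Proof. by rewrite adjZ adj1. Qed.

Lemma adj_unit x : (adj x \is a GRing.unit) = (x \is a GRing.unit).
Proof.
have le y : y \is a GRing.unit -> adj y \is a GRing.unit.
  move=> yU; apply/unitrP; exists (adj y^-1).
  by rewrite -!adjM mulVr// mulrV// adj1.
by apply/idP/idP => /le//; rewrite adjK.
Qed.

Lemma rnorm_adj_mul x : rnorm (adj x * x) = rnorm x ^+ 2.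
Proof.
apply: complexI; rewrite rmorphXn/= -!rnormE; exact: cstar_norm.
Qed.

Lemma rnorm_adj x : rnorm (adj x) = rnorm x.
Proof.
have le y : rnorm y <= rnorm (adj y).
  have [->|] := eqVneq y 0; first by rewrite adj0.
  rewrite -rnorm_gt0 => y0; rewrite -(ler_pM2r y0) -expr2 -rnorm_adj_mul.
  exact: rnorm_mul.
by apply/eqP; rewrite eq_le le andbT -{2}(adjK x) le.
Qed.

Lemma rnorm_one : rnorm (1 : B) = 1.
Proof.
have := rnorm_adj_mul 1; rewrite adj1 mulr1 => h.
have : 0 < rnorm (1 : B) by rewrite rnorm_gt0 oner_neq0.
nra.
Qed.

(** Partial fractions for 1 - v^2 = (1 - v)(1 + v), with v = s y. *)
Lemma inv_one_sub_sqr (s : R[i]) y :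
  1 - s *: y \is a GRing.unit -> 1 + s *: y \is a GRing.unit ->
  1 - s ^+ 2 *: y ^+ 2 \is a GRing.unit /\
  (1 - s ^+ 2 *: y ^+ 2)^-1 =
    2^-1 *: ((1 - s *: y)^-1 + (1 + s *: y)^-1).
Proof.
have -> : s ^+ 2 *: y ^+ 2 = (s *: y) * (s *: y).
  by rewrite -scalerAl -scalerAr scalerA -!expr2.
set v := s *: y => mU pU.
have E1 : 1 - v * v = (1 - v) * (1 + v).
  by rewrite mulrDr mulr1 mulrBl mul1r addrA subrK.
have E2 : 1 - v * v = (1 + v) * (1 - v).
  by rewrite mulrBr mulr1 mulrDl mul1r opprD addrA addrK.
have U : 1 - v * v \is a GRing.unit by rewrite E1 unitrMl.
split=> //; apply: (mulrI U); rewrite mulrV// -scalerAr mulrDr {1}E2 E1.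
rewrite !mulrK// addrACA subrr addr0 (_ : 1 + 1 = 2%:R *: 1) ?scalerA.
  by rewrite mulVf ?scale1r// pnatr_eq0.
by rewrite scaler_nat mulr2n.
Qed.

(* Averaging over the two square roots of a point turns resolvents of y into
   resolvents of y^2 without enlarging the distance between two circles. *)
Lemma sqr_resolvent_close (y : B) (al be e : R) :
  (forall z, rnorm z = 1 -> [/\ 1 - (al%:C * z) *: y \is a GRing.unit,
    1 - (be%:C * z) *: y \is a GRing.unit &
    rnorm ((1 - (al%:C * z) *: y)^-1 - (1 - (be%:C * z) *: y)^-1) <= e]) ->
  forall z, rnorm z = 1 -> [/\ 1 - ((al ^+ 2)%:C * z) *: y ^+ 2 \is a GRing.unit,
    1 - ((be ^+ 2)%:C * z) *: y ^+ 2 \is a GRing.unit &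
    rnorm ((1 - ((al ^+ 2)%:C * z) *: y ^+ 2)^-1 -
           (1 - ((be ^+ 2)%:C * z) *: y ^+ 2)^-1) <= e].
Proof.
move=> H z z1; pose w := sqrtc z.
have wz : w ^+ 2 = z by exact: sqr_sqrtc.
have w1 : rnorm w = 1.
  have : rnorm w ^+ 2 = 1 by rewrite expr2 -rnormM -expr2 wz.
  by move/eqP; rewrite sqrf_eq1 => /orP[/eqP//|/eqP E]; have := rnorm_ge0 w; rewrite E; lra.
have w1' : rnorm (- w) = 1 by rewrite rnormN.
have [a1 b1 c1] := H _ w1; have [a2 b2 c2] := H _ w1'.
rewrite !mulrN !scaleNr !opprK in a2 b2 c2.
have [aU aE] := inv_one_sub_sqr a1 a2.
have [bU bE] := inv_one_sub_sqr b1 b2.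
have sq (k : R) : (k%:C * w) ^+ 2 = (k ^+ 2)%:C * z by rewrite exprMn wz rmorphXn.
rewrite !sq in aU aE bU bE; split=> //.
rewrite aE bE -scalerBr rnormZ opprD addrACA.
have -> : rnorm (2^-1 : R[i]) = 2^-1.
  by rewrite rnormV -(rmorph_nat (@real_complex R)) rnorm_real ger0_norm.
have := rnormD ((1 - (al%:C * w) *: y)^-1 - (1 - (be%:C * w) *: y)^-1)
  ((1 + (al%:C * w) *: y)^-1 - (1 + (be%:C * w) *: y)^-1).
lra.
Qed.

Lemma adj_iter_sqr x m : adj x = x -> adj (x ^+ (2 ^ m)) = x ^+ (2 ^ m).
Proof.
move=> xs; elim: m => [//|m IH].
by rewrite expnSr exprM expr2 adjM IH.
Qed.

Lemma rnorm_iter_sqr x m : adj x = x -> rnorm (x ^+ (2 ^ m)) = rnorm x ^+ (2 ^ m).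
Proof.
move=> xs; elim: m => [//|m IH].
rewrite expnSr !exprM expr2 -{1}(adj_iter_sqr m xs).
by rewrite rnorm_adj_mul IH.
Qed.

(** Scale [x] to [y] of norm 1. If the spectral radius were below 1, the inverses of [1 - z *: y] on
    two circles, just inside and just outside the unit circle, would be close. Repeated squaring
    keeps them close while the radii tend to 0 and to infinity, and the powers of [y] keep norm 1.
    Near radius 0 the inverse is almost 1; at a large radius it cannot be. *)
Lemma rnorm_le_spectral_radius x (r : R) : adj x = x -> 0 <= r ->
  (forall z, x - z%:A \isn't a GRing.unit -> rnorm z <= r) -> rnorm x <= r.
Proof.
move=> xs r0 xr; rewrite leNgt; apply/negP => rx.
set n := rnorm x in rx.
have n0 : 0 < n by exact: le_lt_trans rx.
have nC : n%:C != 0 :> R[i] by rewrite -rnorm_gt0 rnorm_real normr_gt0 gt_eqF.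
pose y : B := n%:C^-1 *: x.
have ys : adj y = y by rewrite adjZ xs -[n%:C^-1](fmorphV (@real_complex R)) conjc_real fmorphV.
have y1 : rnorm y = 1 by rewrite rnormZ rnormV rnorm_real gtr0_norm// mulVf// gt_eqF.
(* Chosen so that [T * r < n]: for a nonzero [z] with [rnorm z <= T], the point [n%:C / z] then has
   norm greater than [r] and lies off the spectrum of [x]. *)
pose d0 := (n - r) / (2 * (r + 1)).
have d00 : 0 < d0 by rewrite divr_gt0//; lra.
pose T := 1 + d0.
have Tr : T * r < n.
  rewrite mulrDl mul1r /d0 mulrAC -ltrBrDl ltr_pdivrMr; last by lra.
  nra.
have yU z : rnorm z <= T -> 1 - z *: y \is a GRing.unit.
  move=> zT; have [->|z0] := eqVneq z 0; first by rewrite scale0r subr0 unitr1.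
  have -> : 1 - z *: y = (- (z / n%:C)) *: (x - (n%:C / z)%:A).
    have zn : z / n%:C * (n%:C / z) = 1 by rewrite mulrA divfK// divff.
    by rewrite /y scalerBr !scalerA mulNr zn scaleN1r opprK scaleNr addrC.
  rewrite scaler_unit ?unitfE ?oppr_eq0 ?mulf_neq0 ?invr_eq0//.
  apply: contraT => /xr; rewrite rnormM rnormV rnorm_real gtr0_norm//.
  rewrite ler_pdivrMr ?rnorm_gt0//.
  have : r * rnorm z <= r * T by exact: ler_wpM2l.
  lra.
have cD : compact [set z : R[i]^o | rnorm z - T <= 0].
  apply: (@compact_sublevel _ (fun z => rnorm z - T) T).
    move=> z; apply: continuousB; first exact: rnorm_continuous.
    exact: cst_continuous.
  by move=> z; rewrite subr_le0.
have [||M M0 yM] := @compact_inv_bounded _ _ nt _ (fun z : R[i]^o => 1 - (z : R[i]) *: y : B) cD.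
- exact: sub_scale_continuous.
- by move=> z /=; rewrite subr_le0 => /yU.
have {}yM z : rnorm z <= T -> rnorm (1 - z *: y)^-1 <= M.
  by move=> zT; apply: yM; rewrite /= subr_le0.
(* The three terms keep the outer circle within radius [T], keep the inner radius positive, and make
   the initial distance [M * (2 * de) * M] at most 1/4. *)
pose de := Num.min d0 (Num.min 2^-1 (8 * M ^+ 2)^-1).
have de0 : 0 < de by rewrite !lt_min d00 !invr_gt0 ltr0n mulr_gt0// exprn_gt0.
have de1 : de <= d0 by rewrite ge_min lexx.
have de2 : de <= 2^-1 by rewrite !ge_min lexx orbT.
have de3 : 2 * de * M ^+ 2 <= 4^-1.
  have : de <= (8 * M ^+ 2)^-1 by rewrite !ge_min lexx !orbT.
  rewrite -[_^-1]mul1r ler_pdivlMr ?mulr_gt0 ?exprn_gt0//; lra.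
pose al := 1 - de; pose be := 1 + de.
have base z : rnorm z = 1 -> [/\ 1 - (al%:C * z) *: y \is a GRing.unit,
    1 - (be%:C * z) *: y \is a GRing.unit &
    rnorm ((1 - (al%:C * z) *: y)^-1 - (1 - (be%:C * z) *: y)^-1) <= 4^-1].
  move=> z1.
  have alT : rnorm (al%:C * z) <= T.
    by rewrite rnormM z1 mulr1 rnorm_real ger0_norm /al /T; lra.
  have beT : rnorm (be%:C * z) <= T.
    by rewrite rnormM z1 mulr1 rnorm_real ger0_norm /be /T; lra.
  have aU := yU _ alT; have bU := yU _ beT; split=> //.
  set s := (1 - (al%:C * z) *: y)^-1; set s' := (1 - (be%:C * z) *: y)^-1.
  have -> : s - s' = s * ((al%:C * z - be%:C * z) *: y) * s'.
    rewrite (_ : _ *: y = (1 - (be%:C * z) *: y) - (1 - (al%:C * z) *: y)); last first.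
      by rewrite scalerBl opprB [RHS]addrC addrA subrK.
    by rewrite mulrBr mulVr// mulrBl mul1r mulrK.
  have e1 := rnorm_mul (s * ((al%:C * z - be%:C * z) *: y)) s'.
  have e2 := rnorm_mul s ((al%:C * z - be%:C * z) *: y).
  have E : rnorm ((al%:C * z - be%:C * z) *: y) = 2 * de.
    rewrite rnormZ y1 mulr1 -mulrBl -rmorphB rnormM z1 mulr1 rnorm_real.
    by rewrite distrC ger0_norm /al /be; lra.
  rewrite E in e2.
  have s0 := rnorm_ge0 s; have s'0 := rnorm_ge0 s'.
  have sM : rnorm s <= M by exact: yM.
  have s'M : rnorm s' <= M by exact: yM.
  rewrite (le_trans e1)// (le_trans _ de3)//.
  have : rnorm s * (2 * de) * rnorm s' <= M * (2 * de) * M.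
    by apply: ler_pM => //; [apply: mulr_ge0 => //; lra|apply: ler_wpM2r => //; lra].
  move=> h; apply: le_trans (le_trans (ler_wpM2r s'0 e2) h) _.
  by rewrite mulrAC mulrC expr2 mulrA.
have iter m z : rnorm z = 1 ->
    [/\ 1 - ((al ^+ (2 ^ m))%:C * z) *: y ^+ (2 ^ m) \is a GRing.unit,
    1 - ((be ^+ (2 ^ m))%:C * z) *: y ^+ (2 ^ m) \is a GRing.unit &
    rnorm ((1 - ((al ^+ (2 ^ m))%:C * z) *: y ^+ (2 ^ m))^-1 -
           (1 - ((be ^+ (2 ^ m))%:C * z) *: y ^+ (2 ^ m))^-1) <= 4^-1].
  elim: m z => [//|m IH] z z1.
  by rewrite expnSr !exprM; exact: sqr_resolvent_close.
pose q := be^-1.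
have be0 : 0 < be by rewrite /be; lra.
have q0 : 0 < q by rewrite invr_gt0.
have q1 : q < 1 by rewrite invf_lt1// /be; lra.
(* Since [al * be <= 1], making [q ^+ N] less than 1/6 gives [al ^+ N <= 6^-1] and [be ^+ N > 6]
   together. The inner inverse is then within 1/4 of 1, the outer one within 1/2, so [U] has norm at
   most 2 and [be ^+ N] would be at most 3. *)
have alq : al <= q by rewrite /q -[be^-1]mul1r ler_pdivlMr// /al /be; nra.
have [|//|m hm] := @geometric_small R q 1 6^-1 _ _; first by rewrite (ltW q0).
have := hm (2 ^ m)%N (ltnW (ltn_expl _ _)); rewrite mul1r => /(_ isT) qN.
have [] := iter m 1 (rnorm1 R); rewrite !mulr1.
have : rnorm (y ^+ (2 ^ m)) = 1 by rewrite rnorm_iter_sqr// y1 expr1n.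
set N := (2 ^ m)%N in qN *; set Y := y ^+ N => Y1.
set s := _^-1; set s' := (_ - (be ^+ N)%:C *: _)^-1 => aU bU ss'.
have al0 : 0 <= al ^+ N by rewrite exprn_ge0// /al; lra.
have alN : al ^+ N <= 6^-1.
  by rewrite (le_trans _ (ltW qN))// lerXn2r ?nnegrE ?(ltW q0)// /al; lra.
have beN : 6 < be ^+ N.
  move: qN; rewrite /q exprVn ltf_pV2 ?posrE ?exprn_gt0//.
have n1 : rnorm ((al ^+ N)%:C *: Y) <= 6^-1.
  by rewrite rnormZ Y1 mulr1 rnorm_real ger0_norm.
have s1 : rnorm (s - 1) <= 4^-1.
  have h : s = 1 + ((al ^+ N)%:C *: Y) * s.
    apply/eqP; rewrite -subr_eq; apply/eqP.
    by rewrite -{1}[s]mul1r -mulrBl mulrV.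
  have -> : s - 1 = ((al ^+ N)%:C *: Y) * s by rewrite {1}h addrAC subrr add0r.
  have e1 := rnorm_mul ((al ^+ N)%:C *: Y) s.
  have e2 := rnormD (1 : B) (((al ^+ N)%:C *: Y) * s : B); rewrite -h rnorm_one in e2.
  have := rnorm_ge0 s; nra.
set U := 1 - (be ^+ N)%:C *: Y in bU s' ss'.
have s'1 : rnorm (1 - s') <= 2^-1.
  have := rnorm_tri (s : B) 1 s'; rewrite (rnorm_distC (1 : B) s); lra.
have UE : U = 1 + U * (1 - s') by rewrite mulrBr mulr1 mulrV// addrC subrK.
have U2 : rnorm U <= 2.
  have e1 := rnormD (1 : B) (U * (1 - s') : B); rewrite -UE rnorm_one in e1.
  have e2 := rnorm_mul U (1 - s'); have := rnorm_ge0 U; nra.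
have : rnorm ((be ^+ N)%:C *: Y) <= 3.
  have -> : (be ^+ N)%:C *: Y = 1 - U by rewrite opprB addrC subrK.
  have := rnormB (1 : B) (U : B); rewrite rnorm_one; lra.
rewrite rnormZ Y1 mulr1 rnorm_real gtr0_norm ?exprn_gt0//; lra.
Qed.

End SelfAdjoint.

(** * Projections obtained from real rank zero *)

Section SpectralProjection.
Variables (R : realType) (A : cstarAlgType R) (nt : bone != 0 :> A).
Local Notation B := (balg nt).
Implicit Types (a b x y u v k h p : B) (z w t : R[i]).

Lemma invertible_unit a : invertible (a : A) <-> a \is a GRing.unit.
Proof.
split=> [[b [ab ba]]|/unitrP[b [ba ab]]]; last by exists b.
by apply/unitrP; exists b.
Qed.

Lemma spectrumP a z : spectrum (a : A) z <-> a - z%:A \isn't a GRing.unit.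
Proof.
by split=> [h|/negP h]; [apply/negP => /invertible_unit|move=> /invertible_unit].
Qed.

Lemma self_adjoint_spectrum_real k z : adj k = k ->
  k - z%:A \isn't a GRing.unit -> (z^*)%C = z.
Proof.
move=> ks; case: z => x y zU; congr (_ +i* _).
have [->|y0] := eqVneq y 0; first by rewrite oppr0.
(* Adding [i t] shifts the spectral point to norm squared [x^2 + (y + t)^2], but the C*-identity
   bounds the shifted norm squared by [rnorm k ^+ 2 + t ^+ 2]. This [t] makes the cross term
   [2 * y * t] exceed [rnorm k ^+ 2] by 1. *)
exfalso; pose t : R := (rnorm k ^+ 2 + 1) / (2 * y).
pose s : R[i] := 0 +i* t.
have sJ : (s^*)%C = - s by rewrite /s; simpc.
have : rnorm (x +i* y + s) <= rnorm (k + s%:A).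
  rewrite leNgt; apply: contra zU => /unit_sub_scalar.
  by rewrite scalerDl opprD addrACA subrr addr0.
rewrite -(ler_pXn2r (n := 2%N)) ?nnegrE ?rnorm_ge0// -rnorm_adj_mul.
rewrite adjD adj_scalar sJ ks.
have -> : (k + (- s)%:A) * (k + s%:A) = k * k + (t ^+ 2)%:C%:A.
  have sk : k * s%:A = s%:A * k by rewrite -scalerAl -scalerAr mulr1 mul1r.
  rewrite scaleNr mulrBl !mulrDr sk opprD addrA addrK; congr (_ + _).
  rewrite -scalerAl -scalerAr !mul1r scalerA -scaleNr; congr (_ *: _).
  by rewrite /s; simpc; rewrite ?opprK -expr2.
rewrite rnorm_sqr /= addr0.
have e1 := rnormD (k * k) ((t ^+ 2)%:C%:A); have e2 := rnorm_mul k k.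
rewrite rnormZ rnorm_one mulr1 rnorm_real ger0_norm ?sqr_ge0// in e1.
have ty : 2 * y * t = rnorm k ^+ 2 + 1.
  by rewrite /t mulrC divfK// mulf_neq0.
have := sqr_ge0 x; have := sqr_ge0 y; nra.
Qed.

Lemma horner_alg_unit_prod k (s : seq R[i]) :
  (forall z, z \in s -> k - z%:A \is a GRing.unit) ->
  horner_alg k (\prod_(z <- s) ('X - z%:P)) \is a GRing.unit.
Proof.
elim: s => [|z s IH] h; first by rewrite big_nil rmorph1 unitr1.
rewrite big_cons rmorphM rmorphB/= horner_algX horner_algC.
rewrite unitrMr.
  by apply: IH => w ws; apply: h; rewrite inE ws orbT.
by apply: h; rewrite inE eqxx.
Qed.

Lemma spectral_mapping k (q : {poly R[i]}) z :
  horner_alg k q - z%:A \isn't a GRing.unit ->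
  exists2 w, k - w%:A \isn't a GRing.unit & q.[w] = z.
Proof.
rewrite -(horner_algC k) -rmorphB => qU.
(* A constant polynomial has no linear factors to examine; any point of the nonempty spectrum
   serves. *)
have [q0|q0] := eqVneq (q - z%:P) 0.
  have [w wU] := spectrum_nonempty k; exists w => //.
  by rewrite (eqP (_ : q == z%:P)) ?hornerC// -subr_eq0 q0.
have [s sE] := closed_field_poly_normal (q - z%:P).
apply: contrapT => nw; move/negP: qU; apply.
rewrite sE -mul_polyC rmorphM/= horner_algC -scalerAl mul1r scaler_unit ?unitfE ?lead_coef_eq0//.
apply: horner_alg_unit_prod => w ws; apply: contrapT => /negP wU.
apply: nw; exists w => //; apply/eqP; rewrite -subr_eq0.
have : root (q - z%:P) w by rewrite sE rootZ ?lead_coef_eq0// root_prod_XsubC.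
by rewrite /root !hornerE.
Qed.

(** Lagrange interpolation: [f] vanishes on the spectrum except at [w]. By spectral mapping
    [(k - w%:A) * F] has only 0 in its spectrum, and being self-adjoint it is 0; so every polynomial
    in [k] acts on [F] as its value at [w], and [F] divided by [f.[w]] is idempotent. *)
Lemma spectral_projection k w : adj k = k -> finite_set (spectrum (k : A)) ->
  k - w%:A \isn't a GRing.unit ->
  exists p, [/\ p != 0, p * p = p, adj p = p & k * p = w *: p].
Proof.
move=> ks /finite_seqP[s0 s0E] wU.
have s0P z : k - z%:A \isn't a GRing.unit -> z \in s0.
  by move=> /spectrumP; rewrite s0E.
pose s := [seq z <- s0 | (k - z%:A \isn't a GRing.unit) && (z != w)].
pose f := \prod_(z <- s) ('X - z%:P); pose F := horner_alg k f.
have fw : f.[w] != 0.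
  by rewrite -/(root f w) root_prod_XsubC mem_filter eqxx andbF.
have sreal z : z \in s -> (z^*)%C = z.
  by rewrite mem_filter => /andP[/andP[zU _] _]; exact: self_adjoint_spectrum_real zU.
have wreal : (w^*)%C = w by exact: self_adjoint_spectrum_real wU.
have Fs : adj F = F.
  rewrite /F /f; elim: s sreal {f F fw} => [|z r IH] zr.
    by rewrite big_nil rmorph1 adj1.
  rewrite big_cons [in LHS]rmorphM adjM IH; last first.
    by move=> v vr; apply: zr; rewrite inE vr orbT.
  have -> : adj (horner_alg k ('X - z%:P)) = horner_alg k ('X - z%:P).
    rewrite rmorphB/= horner_algX horner_algC adjB ks adj_scalar zr//.
    by rewrite inE eqxx.
  by rewrite -rmorphM mulrC.
have kwE : k - w%:A = horner_alg k ('X - w%:P).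
  by rewrite rmorphB/= horner_algX horner_algC.
have kF : (k - w%:A) * F = 0.
  apply/eqP; rewrite -rnorm_eq0 eq_le rnorm_ge0 andbT.
  apply: rnorm_le_spectral_radius => //.
    rewrite adjM Fs adjB ks adj_scalar wreal kwE -!rmorphM.
    by rewrite mulrC.
  move=> z; rewrite kwE -rmorphM => /spectral_mapping[v vU <-].
  rewrite hornerM; have [->|vw] := eqVneq v w; first by rewrite !hornerE subrr mul0r rnorm0.
  have -> : f.[v] = 0.
    by apply/rootP; rewrite root_prod_XsubC mem_filter vU vw s0P.
  by rewrite mulr0 rnorm0.
have mulF g : horner_alg k g * F = g.[w] *: F.
  have : root (g - g.[w]%:P) w by rewrite /root !hornerE subrr.
  move=> /factor_theorem[q /eqP]; rewrite subr_eq => /eqP {1}->.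
  by rewrite rmorphD rmorphM/= -kwE horner_algC mulrDl -mulrA kF mulr0 add0r -scalerAl mul1r.
have F0 : F != 0.
  (* If [F] were 0, evaluating [f - f.[w]%:P = q * ('X - w%:P)] at [k] would yield an inverse of
     [k - w%:A]. *)
  apply: contraNneq wU => F0.
  have : root (f - f.[w]%:P) w by rewrite /root !hornerE subrr.
  move=> /factor_theorem[q /(congr1 (horner_alg k))].
  rewrite [in LHS]rmorphB/= horner_algC -/F F0 sub0r => qE.
  apply/unitrP; exists (- f.[w]^-1 *: horner_alg k q).
  rewrite -scalerAl -scalerAr kwE -!rmorphM/= (mulrC _ q) -qE.
  by rewrite scaleNr scalerN opprK scalerA mulVf// scale1r.
exists (f.[w]^-1 *: F); split.
- by rewrite scaler_eq0 invr_eq0 negb_or fw.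
- by rewrite -scalerAl -scalerAr mulF !scalerA -mulrA mulVf// mulr1.
- rewrite adjZ Fs fmorphV; congr (_^-1 *: _).
  rewrite /f horner_prod rmorph_prod; apply: eq_big_seq => z zs.
  by rewrite !hornerE rmorphB/= wreal sreal.
- have /eqP := kF; rewrite mulrBl subr_eq0 -scalerAl mul1r => /eqP kF'.
  by rewrite -scalerAr kF' !scalerA mulrC.
Qed.

Lemma rnorm_projection p : p != 0 -> p * p = p -> adj p = p -> rnorm p = 1.
Proof.
move=> p0 pp ps; have := rnorm_adj_mul p; rewrite ps pp => h.
have : 0 < rnorm p by rewrite rnorm_gt0.
nra.
Qed.

Hypothesis rr0 : real_rank_zero A.

(** An approximant [k] of finite spectrum within [e / 2] of [h] has a spectral point of norm below
    [e / 2]: otherwise the inverse of [k] would have norm at most [2 / e], and [h] would be a unit.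
    Its eigenprojection serves for [h]. *)
Lemma rr0_projection h (e : R) : adj h = h -> h \isn't a GRing.unit -> 0 < e ->
  exists p, [/\ p != 0, p * p = p, adj p = p & rnorm (h * p) < e].
Proof.
move=> hs hU e0; pose d := e / 2; have d0 : 0 < d by rewrite divr_gt0.
have nb : nbhs (h : A) [set k : A | rnorm (k - (h : A)) < d].
  by apply/rnorm_nbhs; exists d.
have [k [[ks kfin] kh]] := rr0 hs nb.
have {}kh : rnorm ((k : B) - h) < d := kh.
have {}ks : adj (k : B) = k := ks.
have [w wU wd] : exists2 w, (k : B) - w%:A \isn't a GRing.unit & rnorm w < d.
  apply: contrapT => nw.
  have kd w : (k : B) - w%:A \isn't a GRing.unit -> d <= rnorm w.
    by move=> wU; rewrite leNgt; apply/negP => wd; apply: nw; exists w.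
  have kU : (k : B) \is a GRing.unit.
    apply: contraT; rewrite -[k : B]subr0 -(scale0r (1 : B)) => /kd.
    by rewrite rnorm0 leNgt d0.
  have kV : rnorm (k : B)^-1 <= d^-1.
    apply: rnorm_le_spectral_radius; last 2 first.
    - by rewrite invr_ge0 ltW.
    - move=> z zU.
      have z0 : z != 0 by apply: contraNneq zU => ->; rewrite scale0r subr0 unitrV.
      have : d <= rnorm z^-1.
        apply: kd; apply: contra zU => zU.
        have -> : (k : B)^-1 - z%:A = (- z) *: ((k : B)^-1 * ((k : B) - z^-1%:A)).
          rewrite mulrBr mulVr// -scalerAr mulr1 scalerBr scalerA mulNr divff//.
          by rewrite scaleN1r opprK scaleNr addrC.
        by rewrite scaler_unit ?unitfE ?oppr_eq0// unitrMl ?unitrV.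
      by rewrite rnormV => zd; rewrite -[rnorm z]invrK lef_pV2 ?posrE ?invr_gt0 ?rnorm_gt0.
    - by apply: (mulrI kU); rewrite -{1}ks -adjM mulVr// mulrV// adj1.
  move/negP: hU; apply.
  have -> : h = (k : B) * (1 - (k : B)^-1 * ((k : B) - h)).
    by rewrite mulrBr mulr1 mulVKr// opprB addrC subrK.
  rewrite unitrMl//; apply: neumann; rewrite (le_lt_trans (rnorm_mul _ _))//.
  have : d^-1 * rnorm ((k : B) - h) < 1 by rewrite mulrC ltr_pdivrMr// mul1r.
  by apply: le_lt_trans; rewrite ler_wpM2r// rnorm_ge0.
have [p [p0 pp ps kp]] := spectral_projection ks kfin wU.
exists p; split=> //.
have p1 := rnorm_projection p0 pp ps.
have -> : h * p = w *: p - ((k : B) - h) * p by rewrite mulrBl kp opprB addrC subrK.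
have e1 := rnorm_mul ((k : B) - h) p; have e2 := rnormB (w *: p) (((k : B) - h) * p).
rewrite p1 mulr1 in e1; rewrite rnormZ p1 mulr1 in e2.
rewrite (le_lt_trans e2)//; rewrite /d in kh wd; lra.
Qed.

End SpectralProjection.

(** * Openness, and moving an eigenvalue along an idempotent *)

Section DisconnectedSpectrum.
Variables (R : realType) (A : cstarAlgType R) (nt : bone != 0 :> A).
Local Notation B := (balg nt).
Implicit Types (a b x y u v p q : B) (z w t l m : R[i]).

Lemma closed_spectrum a : closed (spectrum (a : A)).
Proof.
rewrite -[spectrum _]setCK; apply: open_closedC; rewrite openE => z0 /= z0U.
have {}z0U : a - (z0 : R[i])%:A \is a GRing.unit.
  by apply: contrapT => /negP /spectrumP.
have [||d d0 dP] := @spectrum_usc _ _ nt (fun z => rnorm (z - z0)) a.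
- move=> z; apply: (@continuous_comp R[i]^o R[i]^o R (fun z => z - z0) (fun z => rnorm z)).
    by apply: continuousB; [exact: cvg_id|exact: cst_continuous].
  exact: rnorm_continuous.
- move=> z; rewrite le_eqVlt ltNge rnorm_ge0 orbF rnorm_eq0 subr_eq0.
  by move=> /eqP ->.
apply/rnorm_nbhs; exists d => // z zd /spectrumP /negP; apply.
have -> : a - (z : R[i])%:A = a - ((z : R[i]) - z0)%:A - z0%:A.
  by rewrite -[RHS]addrA -opprD -scalerDl subrK.
apply: dP; last by rewrite subrr rnorm0.
by rewrite addrAC subrr sub0r rnormN rnormZ rnorm_one mulr1.
Qed.

Lemma disconnected_spectrumP a : disconnected_spectrum (a : A) <->
  exists h : R[i]^o -> R, [/\ continuous h,
    forall z, a - z%:A \isn't a GRing.unit -> h z != 0,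
    exists2 z, a - z%:A \isn't a GRing.unit & h z < 0 &
    exists2 z, a - z%:A \isn't a GRing.unit & 0 < h z].
Proof.
rewrite /disconnected_spectrum not_connectedP; last exact: closed_spectrum.
split=> -[h [hC h0 [z1 s1 h1] [z2 s2 h2]]]; exists h; split=> //.
- by move=> z /spectrumP /h0.
- by exists z1 => //; apply/spectrumP.
- by exists z2 => //; apply/spectrumP.
- by move=> z /spectrumP /h0.
- by exists z1 => //; apply/spectrumP.
- by exists z2 => //; apply/spectrumP.
Qed.

Lemma disconnected_spectrum_near a : disconnected_spectrum (a : A) ->
  exists2 d : R, 0 < d &
    forall b, rnorm (b - a) < d -> disconnected_spectrum (b : A).
Proof.
move=> /disconnected_spectrumP[h [hC h0 [z1 s1 h1] [z2 s2 h2]]].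
have [|d d0 dP] := separated_spectrum_stable hC h1 s1 h2 s2.
  by move=> z hz; apply: contraT => /h0; rewrite hz eqxx.
exists d => // b /dP[b0 [w1 k1 t1] [w2 k2 t2]]; apply/disconnected_spectrumP.
exists h; split=> //; [|by exists w1|by exists w2].
by move=> z zU; apply: contraNneq zU => /b0.
Qed.

Lemma disconnected_spectrum_adj a :
  disconnected_spectrum (a : A) -> disconnected_spectrum (adj a : A).
Proof.
move=> /disconnected_spectrumP[h [hC h0 [z1 s1 h1] [z2 s2 h2]]].
have adjU z : (adj a - z%:A \is a GRing.unit) = (a - (z^*)%C%:A \is a GRing.unit).
  by rewrite -[RHS]adj_unit adjB adj_scalar conjcK.
apply/disconnected_spectrumP; exists (fun z => h (z^*)%C); split.
- move=> z; apply: (@continuous_comp _ _ _ (fun z : R[i]^o => (z : R[i])^*%C : R[i]^o) h).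
    apply/rnorm_continuousP => e e0; exists e => // y.
    by rewrite -[X in X < e -> _]rnorm_conj rmorphB.
  exact: hC.
- by move=> z; rewrite adjU => /h0.
- by exists (z1^*)%C; rewrite ?adjU conjcK.
- by exists (z2^*)%C; rewrite ?adjU conjcK.
Qed.

Lemma unit_add_idempotent p z : p * p = p -> 1 + z != 0 ->
  1 + z *: p \is a GRing.unit.
Proof.
move=> pp z1; set c := z / (1 + z).
have cE : c + c * z = z by rewrite -{1}[c]mulr1 -mulrDr divfK.
have E : z *: p - (c *: p + (c * z) *: p) = 0.
  by rewrite -scalerDl cE subrr.
apply/unitrP; exists (1 - c *: p); split.
  rewrite mulrDr mulr1 mulrBl mul1r -scalerAl -scalerAr pp scalerA.
  by rewrite -addrA (addrCA (- _)) -opprD E addr0.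
rewrite mulrBr mulr1 mulrDl mul1r -scalerAl -scalerAr pp scalerA (mulrC z).
by rewrite -addrA E addr0.
Qed.

(** On the range of [p], [u] acts as [l], so the shifted element minus [z] is [u - z%:A] times
    [1 + ((m - l) / (l - z)) *: p]: away from [l] and [m] no spectrum is created. *)
Lemma unit_shift_on_idempotent u p l m z : p * p = p -> u * p = l *: p ->
  z != l -> z != m -> u - z%:A \is a GRing.unit ->
  u + (m - l) *: p - z%:A \is a GRing.unit.
Proof.
move=> pp up zl zm uU.
have lz : l - z != 0 by rewrite subr_eq0 eq_sym.
have -> : u + (m - l) *: p - z%:A = (u - z%:A) * (1 + ((m - l) / (l - z)) *: p).
  rewrite mulrDr mulr1 -scalerAr (mulrBl p) up -scalerAl mul1r -scalerBl scalerA.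
  by rewrite divfK// addrAC.
rewrite unitrMr//; apply: unit_add_idempotent => //.
have -> : 1 + (m - l) / (l - z) = (m - z) / (l - z) by field.
by rewrite mulf_neq0 ?invr_eq0// subr_eq0 eq_sym.
Qed.

Lemma disconnected_idempotent p l (e : R) : p * p = p -> p != 0 -> p != 1 ->
  0 < e -> disconnected_spectrum (l%:A + e%:C *: p : A).
Proof.
move=> pp p0 p1 e0.
have eC : e%:C != 0 :> R[i] by rewrite -rnorm_gt0 rnorm_real normr_gt0 gt_eqF.
have pU : p \isn't a GRing.unit.
  by apply: contra p1 => pU; apply/eqP/(mulrI pU); rewrite pp mulr1.
have qU : 1 - p \isn't a GRing.unit.
  apply: contra p0 => qU; apply/eqP/(mulrI qU).
  by rewrite mulrBl mul1r pp subrr mulr0.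
apply/disconnected_spectrumP.
exists (fun z => complex.Re z - (complex.Re l + e / 2)); split.
- by move=> z; apply: continuousB; [exact: Re_continuous|exact: cst_continuous].
- move=> z zU.
  have /orP[/eqP->|/eqP->] : (z == l) || (z == l + e%:C).
  + apply: contraNT zU; rewrite negb_or => /andP[zl ze].
    have lz : l - z != 0 by rewrite subr_eq0 eq_sym.
    have -> : l%:A + e%:C *: p - z%:A = (l - z) *: (1 + (e%:C / (l - z)) *: p).
      by rewrite scalerDr scalerA mulrCA divff// mulr1 addrAC scalerBl.
    rewrite scaler_unit ?unitfE//; apply: unit_add_idempotent => //.
    have -> : 1 + e%:C / (l - z) = (l + e%:C - z) / (l - z) by field.
    by rewrite mulf_neq0 ?invr_eq0// subr_eq0 eq_sym.
  + by rewrite lt_eqF//; lra.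
  + by rewrite gt_eqF// raddfD/=; lra.
- exists l; last by lra.
  by rewrite addrAC subrr add0r scaler_unit ?unitfE.
- exists (l + e%:C); last by rewrite raddfD/=; lra.
  rewrite scalerDl opprD addrACA subrr add0r -scalerBr -opprB scalerN -scaleNr.
  by rewrite scaler_unit ?unitfE ?oppr_eq0.
Qed.

(* Otherwise u + (n - l) p would have spectrum {n} for every other n, although
   its quotient by n converges to p, whose spectrum is disconnected. *)
Lemma spectrum_off_idempotent u p l m : p * p = p -> p != 0 -> p != 1 ->
  u * p = l *: p -> m != l -> u - m%:A \is a GRing.unit ->
  exists2 z, z != m & u + (m - l) *: p - z%:A \isn't a GRing.unit.
Proof.
move=> pp p0 p1 up ml mU; apply: contrapT => nz.
have um z : z != m -> u + (m - l) *: p - z%:A \is a GRing.unit.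
  by move=> zm; apply: contraT => zU; case: nz; exists z.
have upm k : (u + (k - l) *: p) * p = k *: p.
  by rewrite mulrDl up -scalerAl pp -scalerDl addrC subrK.
have back k z : z != k -> u + (k - l) *: p - z%:A \is a GRing.unit -> z != l ->
    u - z%:A \is a GRing.unit.
  move=> zk zU zl; have := @unit_shift_on_idempotent _ p k l z pp (upm k) zk zl zU.
  by rewrite -(addrA u) -scalerDl addrA subrK subrr scale0r addr0.
have ul z : z != l -> u - z%:A \is a GRing.unit.
  move=> zl; have [->//|zm] := eqVneq z m.
  by apply: (back m) => //; exact: um.
(* The point [z = l] is out of reach of a shift that starts from [l]; there the shift starts from
   [u + (m - l) *: p], whose eigenvalue is [m]. *)
have un n z : n != l -> n != m -> z != n -> u + (n - l) *: p - z%:A \is a GRing.unit.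
  move=> nl nm zn; have [zl|zl] := eqVneq z l; last first.
    by apply: unit_shift_on_idempotent => //; exact: ul.
  rewrite zl; rewrite zl in zn.
  have := @unit_shift_on_idempotent _ p m n l pp (upm m) _ zn (um l _).
  rewrite eq_sym => /(_ ml ml).
  by rewrite -(addrA u) -scalerDl (addrC (m - l)) addrA subrK.
have pD : disconnected_spectrum (p : A).
  have := @disconnected_idempotent p 0 1 pp p0 p1 ltr01.
  by rewrite scale0r add0r scale1r.
have [d d0 dP] := disconnected_spectrum_near pD.
pose c := rnorm (u - l *: p).
have c0 : 0 <= c := rnorm_ge0 _.
(* [N] exceeds the norms of [l] and [m], hence differs from both, and exceeds [c / d], so that
   [b - p], which is [u - l *: p] divided by [N], has norm below [d]. *)
pose N : R := rnorm l + rnorm m + 1 + (c + 1) / d.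
have cd0 : 0 < (c + 1) / d by rewrite divr_gt0//; lra.
have l0 := rnorm_ge0 l; have m0 := rnorm_ge0 m.
have N0 : 0 < N by rewrite /N; lra.
have NC : rnorm N%:C = N by rewrite rnorm_real gtr0_norm.
have NC0 : N%:C != 0 :> R[i] by rewrite -rnorm_gt0 NC.
have Nl : N%:C != l by apply/eqP => E; move: NC; rewrite E /N; lra.
have Nm : N%:C != m by apply/eqP => E; move: NC; rewrite E /N; lra.
pose b : B := N%:C^-1 *: (u + (N%:C - l) *: p).
have bp : rnorm (b - p) < d.
  have -> : b - p = N%:C^-1 *: (u - l *: p).
    rewrite /b scalerBl addrCA scalerDr scalerA mulVf// scale1r.
    by rewrite addrAC subrr add0r.
  rewrite rnormZ rnormV NC mulrC ltr_pdivrMr// -/c.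
  have : (c + 1) / d < N by rewrite /N; lra.
  by rewrite ltr_pdivrMr// mulrC => /(lt_trans _); apply; rewrite ltrDl.
have /disconnected_spectrumP[h [_ _ [z1 s1 h1] [z2 s2 h2]]] := dP _ bp.
have b1 z : b - z%:A \isn't a GRing.unit -> z = 1.
  move=> zU; apply/eqP; apply: contraNT zU => z1'.
  rewrite -(mulKf NC0 z) scale_unit_sub ?invr_eq0//; apply: un => //.
  by rewrite -[X in _ != X]mulr1 (inj_eq (mulfI NC0)).
by move: h1 h2; rewrite (b1 _ s1) (b1 _ s2) => /lt_trans /[apply]; rewrite ltxx.
Qed.

End DisconnectedSpectrum.

Lemma dim_gt1_nonscalar (K : fieldType) (V : lmodType K) (e : V) :
  dim_gt V 1 -> exists x, forall c, x <> c *: e.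
Proof.
move=> [v vI]; apply: contrapT => nx.
have sc x : exists c, x = c *: e.
  by apply: contrapT => nc; apply: nx; exists x => c xc; apply: nc; exists c.
have [c0 v0] := sc (v ord0); have [c1 v1] := sc (v ord_max).
have c00 : c0 = 0.
  have : \sum_(i < 2) (if i == ord0 then c1 else - c0) *: v i = 0.
    rewrite big_ord_recl big_ord1 /= (_ : lift ord0 ord0 = ord_max); last exact: val_inj.
    by rewrite v0 v1 !scalerA -scalerDl mulrC mulNr subrr scale0r.
  by move/vI => /(_ ord_max) /= /eqP; rewrite oppr_eq0 => /eqP.
have : \sum_(i < 2) (if i == ord0 then 1 else 0) *: v i = 0.
  by rewrite big_ord_recl big_ord1 /= v0 c00 !scale0r scaler0 addr0.
by move/vI => /(_ ord0) /= /eqP; rewrite oner_eq0.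
Qed.

(** * Density of the elements with disconnected spectrum *)

Section Density.
Variables (R : realType) (A : cstarAlgType R) (nt : bone != 0 :> A).
Local Notation B := (balg nt).
Implicit Types (a b x y u v p q : B) (z w t l m : R[i]).
Hypotheses (rr0 : real_rank_zero A) (dim : dim_gt A 1).

(** A non-scalar element has a non-scalar real or imaginary part [y]. For [l] in its spectrum,
    [y - l%:A] is a nonzero nonunit, and taking its own norm as the tolerance excludes [p = 1]. *)
Lemma nontrivial_projection : exists p, [/\ p != 0, p != 1 & p * p = p].
Proof.
have [x xS] := @dim_gt1_nonscalar R[i] A (1 : B) dim.
have [y [ys yS]] : exists y : B, adj y = y /\ forall c : R[i], y != c%:A.
  apply: contrapT => ny.
  have sc y : adj y = y -> exists c : R[i], y = c%:A.
    move=> ys; apply: contrapT => nc; apply: ny; exists y; split=> // c.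
    by apply/eqP => yc; apply: nc; exists c.
  have [c1 E1] : exists c, (x : B) + adj x = c%:A.
    by apply: sc; rewrite adjD adjK addrC.
  have [c2 E2] : exists c, 'i%C *: ((x : B) - adj x) = c%:A.
    have iJ : (('i%C : R[i])^*)%C = - 'i%C by simpc.
    by apply: sc; rewrite adjZ adjB adjK iJ scaleNr -scalerN opprB.
  apply: (xS (2^-1 * (c1 - 'i%C * c2))).
  have -> : (x : B) = 2^-1 *: (((x : B) + adj x) - 'i%C *: ('i%C *: ((x : B) - adj x))).
    rewrite scalerA -expr2 sqr_i scaleN1r opprK addrACA subrr addr0.
    have -> : (x : B) + x = 2%:R *: (x : B) by rewrite scaler_nat mulr2n.
    by rewrite scalerA mulVf ?scale1r// pnatr_eq0.
  by rewrite E1 E2 scalerA -scalerBl scalerA.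
have [l lU] := spectrum_nonempty y.
have lr := self_adjoint_spectrum_real ys lU.
have [|||p [p0 pp ps pe]] := @rr0_projection _ _ nt rr0 (y - l%:A) (rnorm (y - l%:A)).
- by rewrite adjB ys adj_scalar lr.
- exact: lU.
- by rewrite rnorm_gt0 subr_eq0.
exists p; split=> //.
by apply: contraTneq pe => ->; rewrite mulr1 ltxx.
Qed.

Lemma disconnected_approx_left a l (e : R) : 0 < e ->
  adj (a - l%:A) * (a - l%:A) \isn't a GRing.unit ->
  (forall z, a - z%:A \isn't a GRing.unit -> complex.Re z < complex.Re l + e) ->
  exists2 b, rnorm (b - a) < 3 * e & disconnected_spectrum (b : A).
Proof.
move=> e0 lU aRe; set x := a - l%:A in lU.
have [||d d0 dP] := @spectrum_usc _ _ nt (fun z => complex.Re l + e - complex.Re z) a.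
- move=> z; apply: (continuousB (f := fun=> complex.Re l + e)).
    exact: cst_continuous.
  exact: Re_continuous.
- move=> z; rewrite subr_le0 => zl; apply: contraT => /aRe; lra.
(* [r <= d] keeps the spectrum of [a - x * p] to the left of the line at [complex.Re l + e];
   [r <= e] controls the distance moved. *)
pose r := Num.min d e; have r0 : 0 < r by rewrite lt_min d0.
have [|||p [p0 pp ps pr]] := @rr0_projection _ _ nt rr0 (adj x * x) (r ^+ 2).
- by rewrite adjM adjK.
- exact: lU.
- by rewrite exprn_gt0.
have p1 := rnorm_projection p0 pp ps.
have {pr} : rnorm (x * p) < r.
  rewrite -(ltr_pXn2r (n := 2%N)) ?nnegrE ?rnorm_ge0 ?(ltW r0)//.
  rewrite -rnorm_adj_mul (le_lt_trans _ pr)// adjM ps.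
  rewrite -mulrA (le_trans (rnorm_mul _ _))// p1 mul1r mulrA//.
rewrite lt_min => /andP[xd xe].
have [p1'|p1'] := eqVneq p 1.
  have [q [q0 q1 qq]] := nontrivial_projection.
  (* [q] is known only as an idempotent, so its norm must be compensated to keep [k%:C *: q] within
     [e]. *)
  pose k := e / (rnorm q + 1).
  have q0' := rnorm_ge0 q.
  have k0 : 0 < k by rewrite divr_gt0//; lra.
  exists (l%:A + k%:C *: q); last exact: disconnected_idempotent.
  rewrite p1' mulr1 in xe.
  have -> : l%:A + k%:C *: q - a = k%:C *: q - x.
    by rewrite /x opprB addrA (addrC l%:A).
  rewrite (le_lt_trans (rnormB _ _))// rnormZ rnorm_real gtr0_norm//.
  have : k * rnorm q <= e by rewrite /k mulrAC ler_pdivrMr; nra.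
  lra.
(* The new eigenvalue lies at distance [e] beyond the line at [complex.Re l + e]; the total move is
   less than [e + 2 * e]. *)
pose u := a - x * p; pose m := l + (2 * e)%:C.
have up : u * p = l *: p.
  rewrite /u mulrBl -mulrA pp /x mulrBl -scalerAl mul1r opprB addrC subrK//.
have uRe z : u - z%:A \isn't a GRing.unit -> complex.Re z < complex.Re l + e.
  apply: contraNT; rewrite -leNgt => lz; apply: dP; last by rewrite subr_le0.
  by rewrite /u addrAC subrr sub0r rnormN.
have mRe : complex.Re m = complex.Re l + 2 * e by rewrite raddfD.
have mU : u - m%:A \is a GRing.unit.
  by apply: contraT => /uRe; rewrite mRe; lra.
have ml : m != l.
  by apply/eqP => E; move: mRe; rewrite E; lra.
exists (u + (m - l) *: p).
  have -> : u + (m - l) *: p - a = (m - l) *: p - x * p.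
    by rewrite /u addrAC (addrAC a) subrr sub0r addrC.
  rewrite (le_lt_trans (rnormB _ _))// rnormZ p1 mulr1 /m addrAC subrr add0r.
  by rewrite rnorm_real gtr0_norm; lra.
apply/disconnected_spectrumP.
exists (fun z => complex.Re z - (complex.Re l + e)); split.
- by move=> z; apply: continuousB; [exact: Re_continuous|exact: cst_continuous].
- move=> z zU; have [->|zm] := eqVneq z m.
    by rewrite mRe gt_eqF//; lra.
  have [zl|zl] := eqVneq z l; first by rewrite zl lt_eqF//; lra.
  rewrite lt_eqF// subr_lt0; apply: uRe; apply: contra zU.
  exact: unit_shift_on_idempotent.
- have [z zm zU] := spectrum_off_idempotent pp p0 p1' up ml mU.
  exists z => //; have [zl|zl] := eqVneq z l; first by rewrite zl; lra.
  rewrite subr_lt0; apply: uRe; apply: contra zU.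
  exact: unit_shift_on_idempotent.
- exists m; last by rewrite mRe; lra.
  apply: contraNN p0 => U; apply/eqP; apply: (mulrI U).
  rewrite mulr0 mulrBl mulrDl up -scalerAl pp -scalerDl -scalerAl mul1r.
  by rewrite addrC (addrC l) subrK addNr.
Qed.

Lemma disconnected_approx a (e : R) : 0 < e ->
  exists2 b, rnorm (b - a) < e & disconnected_spectrum (b : A).
Proof.
move=> e0; pose S := [set complex.Re z | z in [set z | a - z%:A \isn't a GRing.unit]].
have supS : has_sup S.
  split; first by have [z zU] := spectrum_nonempty a; exists (complex.Re z), z.
  exists (rnorm a) => _ [z /= zU <-].
  apply: le_trans (ler_norm _) _; apply: le_trans (Re_rnorm _) _.
  by rewrite leNgt; apply: contra zU; exact: unit_sub_scalar.
have e3 : 0 < e / 3 by rewrite divr_gt0.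
have [_ [l lU <-] lS] := sup_adherent e3 supS.
have aRe z : a - z%:A \isn't a GRing.unit -> complex.Re z < complex.Re l + e / 3.
  move=> zU; have : complex.Re z <= sup S by apply: sup_ubound; [case: supS|exists z].
  lra.
have eE : 3 * (e / 3) = e by rewrite mulrC divfK.
(* If [adj x * x] is a unit, [x] has a left inverse; were [x * adj x] a unit too, [x] would be one.
   So the left case applies to [adj a], whose spectrum is the conjugate and has the same real
   parts. *)
have [xU|xU] := boolP (adj (a - l%:A) * (a - l%:A) \is a GRing.unit); last first.
  by have := disconnected_approx_left e3 xU aRe; rewrite eE.
have [||b ba bD] := @disconnected_approx_left (adj a) (l^*)%C (e / 3) e3.
- have -> : adj a - (l^*)%C%:A = adj (a - l%:A) by rewrite adjB adj_scalar.
  rewrite adjK; apply: contra lU => yU.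
  set x := a - l%:A in xU yU *.
  pose u := adj x * (x * adj x)^-1; pose v := (adj x * x)^-1 * adj x.
  have xu : x * u = 1 by rewrite mulrA mulrV.
  have vx : v * x = 1 by rewrite -mulrA mulVr.
  have uv : v = u by rewrite -[LHS]mulr1 -xu mulrA vx mul1r.
  by apply/unitrP; exists v; rewrite {2}uv.
- move=> z; have -> : adj a - z%:A = adj (a - (z^*)%C%:A) by rewrite adjB adj_scalar conjcK.
  by rewrite adj_unit => /aRe; case: z (l) => ? ? [].
exists (adj b); last exact: disconnected_spectrum_adj.
by rewrite -eE -(adjK a) -adjB rnorm_adj.
Qed.

End Density.

Theorem corollary1p3 (R : realType) (A : cstarAlgType R)
  (hrr0 : real_rank_zero A) (hdim : dim_gt A 1) :
  open [set a : A | disconnected_spectrum a] /\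
  dense [set a : A | disconnected_spectrum a].
Proof.
have nt : bone != 0 :> A.
  have [x xS] := dim_gt1_nonscalar bone hdim.
  apply/eqP => b0; apply: (xS 0).
  by rewrite -[LHS]bmul1l b0 -(scale0r 0) bmulZl !scale0r.
split.
  rewrite openE => a aD; apply/rnorm_nbhs.
  exact: (@disconnected_spectrum_near _ _ nt a aD).
move=> O [a Oa] oO.
have /rnorm_nbhs[e e0 eO] : nbhs a O by exact: open_nbhs_nbhs.
have [b ba bD] := @disconnected_approx _ _ nt hrr0 hdim a e e0.
by exists b; split=> //; exact: eO.
Qed.
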